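(* Let $d\in[1,+\infty]$, let $(D_t)_{t\ge 0}$ be a canonical domain system of order $d$, and let $(f_t)_{t\ge0}$ be a Loewner chain of order $d$ over $(D_t)$. Define $$\varphi_{s,t}:=f_t^{-1}\circ f_s,\qquad 0\le s\le t<\infty.$$ Then $(\varphi_{s,t})_{0\le s\le t<\infty}$ is an evolution family of order $d$ over $(D_t)$.
   Context: Notation: $\mathbb A_r:=\{z\in\mathbb C: r<|z|<1\}$ for $0\le r<1$; $\mathbb D^*:=\mathbb A_0$. For $d\in[1,+\infty]$, $AC^d(X,Y)$ ($X\subset\mathbb R$, $Y\subset\mathbb C$) is the class of all locally absolutely continuous $f:X\to Y$ with $f'\in L^d_{\mathrm{loc}}(X,\mathbb C)$. Put $\omega(r):=-\pi/\log r$ for $r\in(0,1)$ and $\omega(0):=0$. ''Univalent'' means holomorphic and injective. Canonical domain system of order $d$: a family $(D_t)_{t\ge0}$ of annuli $D_t=\mathbb A_{r(t)}$, $r(t)\in[0,1)$, such that $t\mapsto\omega(r(t))$ belongs to $AC^d([0,+\infty),[0,+\infty))$ and is non-increasing. Loewner chain of order $d$ over $(D_t)$: a family $(f_t)_{t\ge0}$ of holomorphic functions $f_t:D_t\to\mathbb C$ such that (LC1) each $f_t$ is univalent; (LC2) $f_s(D_s)\subset f_t(D_t)$ whenever $0\le s<t<+\infty$; (LC3) for any compact interval $I=[S,T]\subset[0,+\infty)$ and any compact set $K\subset D_S$ there is a non-negative function $k_{K,I}\in L^d([S,T],\mathbb R)$ such that $|f_s(z)-f_t(z)|\le\int_s^t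 k_{K,I}(\xi)\,d\xi$ for all $z\in K$ and all $S\le s\le t\le T$. Evolution family of order $d$ over $(D_t)$: a family $(\varphi_{s,t})_{0\le s\le t<+\infty}$ of holomorphic mappings $\varphi_{s,t}:D_s\to D_t$ such that (EF1) $\varphi_{s,s}=\mathrm{id}_{D_s}$; (EF2) $\varphi_{s,t}=\varphi_{u,t}\circ\varphi_{s,u}$ whenever $0\le s\le u\le t<+\infty$; (EF3) for any closed interval $I=[S,T]\subset[0,+\infty)$ and any $z\in D_S$ there is a non-negative function $k_{z,I}\in L^d([S,T],\mathbb R)$ such that $|\varphi_{s,u}(z)-\varphi_{s,t}(z)|\le\int_u^t k_{z,I}(\xi)\,d\xi$ whenever $S\le s\le u\le t\le T$. *)

(* Defs.v *)
From HB Require Import structures.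
From mathcomp Require Import all_boot all_order all_algebra.
From mathcomp Require Import all_classical all_reals all_analysis.
From mathcomp Require Export complex.

Set Implicit Arguments.
Unset Strict Implicit.
Unset Printing Implicit Defensive.

Import Order.TTheory GRing.Theory Num.Theory.
Import numFieldNormedType.Exports.

Local Open Scope classical_set_scope.
Local Open Scope ring_scope.

(* [R[i]^o] is [R[i]] viewed as a normed module over the field [R[i]] itself:
   its topology is the usual one of the plane, and [derivable f z 1] is
   complex differentiability of [f] at [z].  The norm [`|z|] takes values in
   [R[i]], where [x <= y] means that [y - x] is a nonnegative real. *)
Notation cplx R := ((R[i])^o).

(* Maps and families are total functions; only their values on the stated
   domains (and at times t >= 0) matter. *)

Definition annulus (R : realType) (r : R) : set (cplx R) :=
  [set z | r%:C%C < `|z| < 1].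

Definition holomorphic_on (R : realType) (A : set (cplx R))
    (f : cplx R -> cplx R) : Prop :=
  open A /\ forall z, A z -> derivable f z 1.

Definition univalent_on (R : realType) (A : set (cplx R))
    (f : cplx R -> cplx R) : Prop :=
  holomorphic_on A f /\ {in A &, injective f}.

Definition Ld_on (R : realType) (d : \bar R) (a b : R) (g : R -> R) : Prop :=
  (g \_ `[a, b]) \in Lfun lebesgue_measure d.

Definition abs_continuous_on (R : realType) (a b : R) (f : R -> R) : Prop :=
  forall e : R, 0 < e -> exists2 delta : R, 0 < delta &
    forall (n : nat) (u v : 'I_n -> R),
      (forall i, a <= u i /\ u i <= v i /\ v i <= b) ->
      trivIset setT (fun i => `]u i, v i[%classic) ->
      \sum_(i < n) (v i - u i) < delta ->
      \sum_(i < n) `|f (v i) - f (u i)| < e.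

(* AC^d(X, Y) for Y a set of reals.  The derivative of a locally absolutely
   continuous function exists almost everywhere; the values of [derive1 f] on the
   remaining null set, as well as at the endpoints of X, are irrelevant. *)
Definition ACd (R : realType) (d : \bar R) (X Y : set R) (f : R -> R) : Prop :=
  (forall x, X x -> Y (f x)) /\
  (forall a b : R, `[a, b] `<=` X ->
     abs_continuous_on a b f /\ Ld_on d a b (derive1 f)).

Definition omega (R : realType) (r : R) : R :=
  if r == 0 then 0 else - pi / ln r.

Definition canonical_domain_system (R : realType) (d : \bar R)
    (D : R -> set (cplx R)) : Prop :=
  exists r : R -> R,
    [/\ forall t, 0 <= t -> 0 <= r t < 1,
        forall t, 0 <= t -> D t = annulus (r t),
        ACd d `[0, +oo[ `[0, +oo[ (fun t => omega (r t)) &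
        forall s t, 0 <= s -> s <= t -> omega (r t) <= omega (r s)].

Definition loewner_chain (R : realType) (d : \bar R) (D : R -> set (cplx R))
    (f : R -> cplx R -> cplx R) : Prop :=
  [/\ forall t, 0 <= t -> univalent_on (D t) (f t),
      forall s t, 0 <= s -> s < t -> f s @` D s `<=` f t @` D t &
      forall (S T : R) (K : set (cplx R)),
        0 <= S -> S <= T -> compact K -> K `<=` D S ->
        exists k : R -> R,
          [/\ forall x, x \in `[S, T] -> 0 <= k x,
              Ld_on d S T k &
              forall z s t, K z -> S <= s -> s <= t -> t <= T ->
                `|f s z - f t z|
                  <= (\int[lebesgue_measure]_(x in `[s, t]) k x)%:C%C]].

Definition evolution_family (R : realType) (d : \bar R)
    (D : R -> set (cplx R)) (phi : R -> R -> cplx R -> cplx R) : Prop :=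
  [/\ forall s t, 0 <= s -> s <= t ->
        holomorphic_on (D s) (phi s t) /\ phi s t @` D s `<=` D t,
      forall s z, 0 <= s -> D s z -> phi s s z = z,
      forall s u t z, 0 <= s -> s <= u -> u <= t -> D s z ->
        phi s t z = phi u t (phi s u z) &
      forall (S T : R) (z : cplx R), 0 <= S -> S <= T -> D S z ->
        exists k : R -> R,
          [/\ forall x, x \in `[S, T] -> 0 <= k x,
              Ld_on d S T k &
              forall s u t, S <= s -> s <= u -> u <= t -> t <= T ->
                `|phi s u z - phi s t z|
                  <= (\int[lebesgue_measure]_(x in `[u, t]) k x)%:C%C]].

(* phi_{s,t} = f_t^{-1} o f_s, with f_t^{-1} : f_t(D_t) -> D_t. *)
Definition chain_transition (R : realType) (D : R -> set (cplx R))
    (f : R -> cplx R -> cplx R) (s t : R) : cplx R -> cplx R :=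
  'pinv_(fun=> 0) (D t) (f t) \o f s.

(* Main.v *)
Require Import Defs.
From mathcomp Require Import all_boot all_order all_algebra.
From mathcomp Require Import all_classical all_reals all_analysis.
From mathcomp Require Import ring lra.

(** Put phi_{s,t} = f_t^{-1} o f_s, so that f_t (phi_{s,t} z) = f_s z; by
    injectivity of f_t on D_t this equation determines phi_{s,t} z in D_t.  The
    identity and composition laws follow at once from this uniqueness.

    What remains is analysis: phi_{s,t} is holomorphic, and t |-> phi_{s,t} z
    has increments bounded by the integral of one L^d function.  Both rest on
    [stable_local_inverse]: if f is univalent on a disc about w, there are
    constants such that every holomorphic h uniformly close to f on that disc
    satisfies c |a - b| <= |h a - h b| for a, b near w, and takes every value
    near h w at a point near w.  For h = f this gives differentiability of the
    inverse.  For the increments, the family is locally uniformly continuous in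
    time, so it applies to h = f_t for all t near a given time u0, with w the
    point phi_{s0,u0} z.  It keeps phi_{s,u} z and phi_{s,t} z near w for all
    nearby s, u, t, and then, as f_t (phi_{s,t} z) = f_u (phi_{s,u} z),
      c |phi_{s,u} z - phi_{s,t} z|
        <= |f_t (phi_{s,u} z) - f_u (phi_{s,u} z)| <= int_u^t k.
    Two compactness arguments, first in the times u, t and then in s, add up
    finitely many such functions k.  Continuity of the radii is used here: the
    point w of D_{u0} must already lie in D_t for t slightly less than u0, since
    the chain is controlled only on compact subsets of the initial domain.

    Holomorphy means pointwise complex differentiability, so
    [stable_local_inverse] starts from Goursat's theorem ([goursat]), proved by
    bisecting triangles.  It yields Cauchy's formula on a square
    ([cauchy_formula]), and from it a continuous slope function
    G_f(a, b) = kappa^{-1} oint f(z) / ((z - a)(z - b)) dz with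
    f a - f b = (a - b) G_f(a, b) and G_f(a, a) = f' a, which depends linearly
    and continuously on the values of f on the contour.  The crucial point is
    that G_f(w, w) is nonzero for univalent f ([univalent_slope_neq0]).  If it
    vanished, a maximum principle applied to 1 / G_f(a, .) would force G_f(a, .)
    to have a zero for each a near w; by injectivity that zero can only be a
    itself, so f' = 0 near w and f would be constant there. *)

Set Implicit Arguments.
Unset Strict Implicit.
Unset Printing Implicit Defensive.

Import Order.TTheory GRing.Theory Num.Theory.
Import numFieldNormedType.Exports.
Import Normc.

Local Open Scope classical_set_scope.
Local Open Scope complex_scope.
Local Open Scope ring_scope.

Local Notation Re := (@complex.Re _).
Local Notation Im := (@complex.Im _).

(** * Moduli, continuity and differentiability on the complex plane *)

Section Modulus.
Variable R : realType.
Implicit Types (z w : R[i]) (x : R).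

Lemma norm_normc z : `|z| = (normc z)%:C.
Proof. by []. Qed.

Lemma normc_ge0 z : 0 <= normc z.
Proof. by rewrite -ler0c -norm_normc normr_ge0. Qed.

Lemma normc_real x : normc x%:C = `|x|.
Proof. by rewrite /= expr0n /= addr0 sqrtr_sqr. Qed.

Lemma normcD z w : normc (z + w) <= normc z + normc w.
Proof. by rewrite -lecR rmorphD /= -!norm_normc ler_normD. Qed.

Lemma normc_opp z : normc (- z) = normc z.
Proof. by apply: complexI; rewrite -!norm_normc normrN. Qed.

Lemma normc_distC z w : normc (z - w) = normc (w - z).
Proof. by rewrite -normc_opp opprB. Qed.

Lemma normc_dist_tri u z w : normc (z - w) <= normc (z - u) + normc (u - w).
Proof. by rewrite (le_trans _ (normcD _ _))// addrA subrK. Qed.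

Lemma normc_dist_ge z w : normc z - normc w <= normc (z - w).
Proof. by have := normcD (z - w) w; rewrite subrK lerBlDr. Qed.

Lemma normc_eq0 z : (normc z == 0) = (z == 0).
Proof. by apply/eqP/eqP => [/eq0_normc//|->]; rewrite normc0. Qed.

Lemma normc_gt0 z : (0 < normc z) = (z != 0).
Proof. by rewrite lt0r normc_eq0 normc_ge0 andbT. Qed.

Lemma abs_Re z : `|Re z| <= normc z.
Proof. by rewrite -lecR -norm_normc normc_ge_Re. Qed.

Lemma abs_Im z : `|Im z| <= normc z.
Proof.
case: z => a b /=; rewrite -sqrtr_sqr ler_wsqrtr// lerDr sqr_ge0 //.
Qed.

Lemma normc_le_ReIm z : normc z <= `|Re z| + `|Im z|.
Proof.
rewrite {1}(complexE z) (le_trans (normcD _ _))// normc_real normcM.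
by rewrite normc_real /= expr0n expr1n /= add0r sqrtr1 mul1r.
Qed.

Lemma ReD z w : Re (z + w) = Re z + Re w. Proof. by case: z; case: w. Qed.
Lemma ImD z w : Im (z + w) = Im z + Im w. Proof. by case: z; case: w. Qed.
Lemma ReN z : Re (- z) = - Re z. Proof. by case: z. Qed.
Lemma ImN z : Im (- z) = - Im z. Proof. by case: z. Qed.
Lemma ReB z w : Re (z - w) = Re z - Re w. Proof. by rewrite ReD ReN. Qed.
Lemma ImB z w : Im (z - w) = Im z - Im w. Proof. by rewrite ImD ImN. Qed.
Lemma ReM z w : Re (z * w) = Re z * Re w - Im z * Im w.
Proof. by case: z; case: w. Qed.
Lemma ImM z w : Im (z * w) = Re z * Im w + Im z * Re w.
Proof. by case: z => a b; case: w => c d /=. Qed.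

Lemma contcP (f : cplx R -> cplx R) (z : cplx R) :
  {for z, continuous f} <->
  (forall e : R, 0 < e -> exists2 dl : R, 0 < dl &
     forall w, normc (w - z) < dl -> normc (f w - f z) < e).
Proof.
split.
  move=> /cvgrPdist_lt fz e e0.
  have e0' : 0 < e%:C :> R[i] by rewrite ltcR.
  have /nbhs_ballP[d /= d0 df] := fz _ e0'.
  have dE : d = (Re d)%:C by rewrite RRe_real// gtr0_real.
  exists (Re d); first by rewrite -ltcR -dE.
  move=> w wz; have := df w; rewrite /ball /= distrC norm_normc dE ltcR.
  by move=> /(_ wz); rewrite distrC norm_normc ltcR.
move=> H; apply/(@cvgrPdist_lt R[i] (cplx R) _ _ (nbhs_filter z)) => e e0.
have eE : e = (Re e)%:C by rewrite RRe_real// gtr0_real.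
have [|d d0 dH] := H (Re e); first by rewrite -ltcR -eE.
apply/nbhs_ballP; exists d%:C; first by rewrite /= ltcR.
move=> w; rewrite /ball /= => wz; rewrite eE distrC norm_normc ltcR dH//.
by rewrite -ltcR -norm_normc distrC.
Qed.

Lemma cont_pathP (f : R -> cplx R) (t : R) :
  {for t, continuous f} <->
  (forall e : R, 0 < e -> exists2 dl : R, 0 < dl &
     forall u, `|u - t| < dl -> normc (f u - f t) < e).
Proof.
split.
  move=> /cvgrPdist_lt fz e e0.
  have e0' : 0 < e%:C :> R[i] by rewrite ltcR.
  have /nbhs_ballP[d /= d0 df] := fz _ e0'.
  exists d => // u ut.
  have := df u; rewrite /ball /= distrC => /(_ ut).
  by rewrite distrC norm_normc ltcR.
move=> H; apply/cvgrPdist_lt => e e0.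
have eE : e = (Re e)%:C by rewrite RRe_real// gtr0_real.
have [|d d0 dH] := H (Re e); first by rewrite -ltcR -eE.
apply/nbhs_ballP; exists d => //.
move=> w; rewrite /ball /= => wz; rewrite eE distrC norm_normc ltcR dH//.
by rewrite distrC.
Qed.

Lemma contRP (f : R -> R) (t : R) :
  (forall e : R, 0 < e -> exists2 dl : R, 0 < dl &
     forall u, `|u - t| < dl -> `|f u - f t| < e) -> {for t, continuous f}.
Proof.
move=> H; apply/cvgrPdist_lt => e e0; have [d d0 dH] := H e e0.
apply/nbhs_ballP; exists d => // w; rewrite /ball /= distrC => /dH.
by rewrite distrC.
Qed.

Lemma scale1E (h : cplx R) : h *: (1 : cplx R) = h.
Proof. exact: mulr1. Qed.

Lemma diffquotE (h x l : cplx R) : h != 0 -> h * (h^-1 *: x - l) = x - l * h.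
Proof.
by move=> h0; rewrite mulrBr [h * l]mulrC; congr (_ - _); exact: mulVKf.
Qed.

(** The form of differentiability that tolerates a zero increment, which
    is what Goursat's argument and the slope estimates manipulate. *)
Lemma derivcP (f : cplx R -> cplx R) (z : cplx R) :
  derivable f z 1 <-> exists l : cplx R,
  (forall e : R, 0 < e -> exists2 dl : R, 0 < dl &
     forall w, normc (w - z) < dl ->
       normc (f w - f z - l * (w - z)) <= e * normc (w - z)).
Proof.
split.
  move=> /cvg_ex[l /cvgrPdist_le fz]; exists l => e e0.
  have e0' : 0 < e%:C :> R[i] by rewrite ltcR.
  have /nbhs_ballP[d /= d0 df] := fz _ e0'.
  have dE : d = (Re d)%:C by rewrite RRe_real// gtr0_real.
  exists (Re d); first by rewrite -ltcR -dE.
  move=> w wz; have [->|wNz] := eqVneq w z.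
    by rewrite !subrr mulr0 subrr normc0 mulr0.
  have wz0 : w - z != 0 by rewrite subr_eq0.
  have := df (w - z); rewrite /ball /= sub0r normrN norm_normc dE ltcR.
  move=> /(_ wz wz0); rewrite distrC norm_normc lecR => H.
  have -> : f w - f z - l * (w - z) =
      (w - z) * ((w - z)^-1 *: (f ((w - z) *: 1 + z) - f z) - l).
    by rewrite scale1E subrK diffquotE.
  by rewrite normcM mulrC ler_wpM2r ?normc_ge0.
move=> [l H]; apply/cvg_ex; exists l; apply/cvgrPdist_le => e e0.
have eE : e = (Re e)%:C by rewrite RRe_real// gtr0_real.
have [|d d0 dH] := H (Re e); first by rewrite -ltcR -eE.
apply/nbhs_ballP; exists d%:C; first by rewrite /= ltcR.
move=> h; rewrite /ball /= sub0r normrN norm_normc ltcR => hd h0.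
have := dH (h + z); rewrite addrK => /(_ hd).
rewrite eE distrC norm_normc lecR.
have -> : f (h + z) - f z - l * h =
      h * (h^-1 *: (f (h *: 1 + z) - f z) - l).
  by rewrite scale1E diffquotE.
by rewrite normcM mulrC ler_pM2r ?normc_gt0.
Qed.

Lemma derivable_cont (f : cplx R -> cplx R) (z : cplx R) :
  derivable f z 1 -> {for z, continuous f}.
Proof. by move=> /derivable1_diffP/differentiable_continuous. Qed.

End Modulus.

(** * Integrals of continuous functions over the unit interval *)

Section UnitIntegral.
Variable R : realType.
Implicit Types (g h : R -> R) (a b t : R).
Local Notation mu := (@lebesgue_measure R).

Lemma within_cc a b g :
  (forall t, a <= t <= b -> {for t, continuous g}) ->
  {within `[a, b], continuous g}.
Proof.
move=> gc; apply: continuous_in_subspaceT => t /[!inE] /=.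
by rewrite in_itv /= => /gc.
Qed.

Lemma integrable_cc a b g :
  (forall t, a <= t <= b -> {for t, continuous g}) ->
  mu.-integrable `[a, b] (EFin \o g).
Proof.
move=> gc; apply: continuous_compact_integrable; first exact: segment_compact.
exact: within_cc.
Qed.

Definition unit_int g : R := \int[mu]_(t in `[0, 1]) g t.

Lemma eq_unit_int g h : (forall t, 0 <= t <= 1 -> g t = h t) -> unit_int g = unit_int h.
Proof.
by move=> gh; apply: eq_Rintegral => t /[!inE] /=; rewrite in_itv /= => /gh.
Qed.

Lemma unit_intD g h :
  (forall t, 0 <= t <= 1 -> {for t, continuous g}) ->
  (forall t, 0 <= t <= 1 -> {for t, continuous h}) ->
  unit_int (fun t => g t + h t) = unit_int g + unit_int h.
Proof. by move=> gc hc; apply: RintegralD => //; exact: integrable_cc. Qed.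

Lemma unit_intZ k g :
  (forall t, 0 <= t <= 1 -> {for t, continuous g}) ->
  unit_int (fun t => k * g t) = k * unit_int g.
Proof. by move=> gc; apply: RintegralZl => //; exact: integrable_cc. Qed.

Lemma unit_int_cst k : unit_int (fun=> k) = k.
Proof.
rewrite /unit_int Rintegral_cst//= lebesgue_measure_itv /= lte_fin ltr01.
by rewrite oppr0 adde0 mulr1.
Qed.

Lemma le_unit_int g h :
  (forall t, 0 <= t <= 1 -> {for t, continuous g}) ->
  (forall t, 0 <= t <= 1 -> {for t, continuous h}) ->
  (forall t, 0 <= t <= 1 -> g t <= h t) -> unit_int g <= unit_int h.
Proof.
by move=> gc hc gh; apply: le_Rintegral => //; exact: integrable_cc.
Qed.

Lemma unit_int_bound g (M : R) :
  (forall t, 0 <= t <= 1 -> {for t, continuous g}) ->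
  (forall t, 0 <= t <= 1 -> `|g t| <= M) -> `|unit_int g| <= M.
Proof.
move=> gc gM; have cc k : forall t, 0 <= t <= 1 -> {for t, continuous (fun=> k : R)}.
  by move=> t _; exact: cvg_cst.
rewrite ler_norml; apply/andP; split; last first.
  rewrite -[leRHS]unit_int_cst; apply: (le_unit_int gc (cc M)) => t /gM.
  by rewrite ler_norml => /andP[].
rewrite -[leLHS]unit_int_cst; apply: (le_unit_int (cc (- M)) gc) => t /gM.
by rewrite ler_norml => /andP[].
Qed.

(** Reduces integrals over subintervals to the unit interval; used to halve
    the domain of integration. *)
Lemma int_affine_subst a b g : a < b ->
  (forall t, a <= t <= b -> {for t, continuous g}) ->
  \int[mu]_(t in `[a, b]) g t = (b - a) * unit_int (fun t => g (a + (b - a) * t)).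
Proof.
move=> ab gc; pose F t := a + (b - a) * t.
have F0 : F 0 = a by rewrite /F mulr0 addr0.
have F1 : F 1 = b by rewrite /F mulr1 addrC subrK.
have ba : 0 < b - a by rewrite subr_gt0.
have dF t : is_derive t 1 F (b - a).
  rewrite /F; apply: is_derive_eq.
  by rewrite add0r mul1r /GRing.scale /= mulr1.
have F' : (F^`())%classic = cst (b - a).
  by apply/funext => t; rewrite derive1E derive_val.
have cF t : {for t, continuous F}.
  by apply/differentiable_continuous/derivable1_diffP; exact: ex_derive.
have gF t : 0 <= t <= 1 -> {for t, continuous (g \o F)}.
  move=> /andP[t0 t1]; apply: continuous_comp => //.
  by apply: gc; rewrite /F; apply/andP; split; nra.
rewrite -/((b - a) * unit_int (g \o F)) -(unit_intZ (b - a) gF).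
rewrite -{1}F0 -{1}F1 /unit_int /Rintegral; congr fine.
rewrite (@integration_by_substitution_increasing _ F) //.
- by apply: eq_integral => t _; rewrite F' /= mulrC.
- by move=> x y _ _ xy; rewrite /F; nra.
- by rewrite F' => t _; exact: cvg_cst.
- by rewrite F'; exact: is_cvg_cst.
- by rewrite F'; exact: is_cvg_cst.
- split => //.
  + exact/cvg_at_right_filter/cF.
  + exact/cvg_at_left_filter/cF.
- by rewrite F0 F1; exact: within_cc.
Qed.

Lemma unit_int_half g :
  (forall t, 0 <= t <= 1 -> {for t, continuous g}) ->
  unit_int g = 2^-1 * (unit_int (fun t => g (2^-1 * t)) +
                   unit_int (fun t => g (2^-1 + 2^-1 * t))).
Proof.
move=> gc.
have i01 : mu.-integrable `[0, 1] (EFin \o g) by exact: integrable_cc.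
have h0 : (0 : R) < 2^-1 by rewrite invr_gt0.
have h1 : 2^-1 < 1 :> R by rewrite invf_lt1 ?ltr1n.
have := @Rintegral_itvB _ g (BLeft 0) (BRight 1) 2^-1 i01.
rewrite !bnd_simp => /(_ (ltW h0) (ltW h1)) /eqP.
rewrite subr_eq addrC => /eqP; rewrite {1}/unit_int => ->.
rewrite Rintegral_itv_obnd_cbnd; last first.
  apply: integrableS i01 => //; move=> t /=; rewrite !in_itv /= => /andP[t1 t2].
  by rewrite t2 (ltW (lt_trans h0 t1)).
rewrite !int_affine_subst//.
- have -> : 1 - 2^-1 = 2^-1 :> R by lra.
  rewrite subr0 -mulrDr; congr (_ * (_ + _)).
  by apply: eq_unit_int => t _; rewrite add0r.
- by move=> t /andP[t0 t1]; apply: gc; rewrite (le_trans (ltW h0)).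
- by move=> t /andP[t0 t1]; apply: gc; rewrite t0 (le_trans t1 (ltW h1)).
Qed.

Lemma unit_int_rev g :
  (forall t, 0 <= t <= 1 -> {for t, continuous g}) ->
  unit_int g = unit_int (fun t => g (1 - t)).
Proof.
move=> gc; rewrite /unit_int Rintegration_by_substitution_onem ?ler01 ?lexx//.
  by rewrite unstable.onem1.
exact: within_cc.
Qed.

End UnitIntegral.

(** * Complex integrals along segments *)

Section SegmentIntegral.
Variable R : realType.
Implicit Types (g h : R -> cplx R) (F G : cplx R -> cplx R).
Implicit Types (p q r a c : R[i]) (t : R).

Definition path_cont g := forall t, 0 <= t <= 1 -> {for t, continuous g}.

Lemma path_cont_Re g : path_cont g ->
  forall t, 0 <= t <= 1 -> {for t, continuous (fun t => Re (g t))}.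
Proof.
move=> gc t t01; apply: contRP => e e0.
have [d d0 H] := (cont_pathP g t).1 (gc t t01) e e0.
by exists d => // u /H; apply: le_lt_trans; rewrite -ReB abs_Re.
Qed.

Lemma path_cont_Im g : path_cont g ->
  forall t, 0 <= t <= 1 -> {for t, continuous (fun t => Im (g t))}.
Proof.
move=> gc t t01; apply: contRP => e e0.
have [d d0 H] := (cont_pathP g t).1 (gc t t01) e e0.
by exists d => // u /H; apply: le_lt_trans; rewrite -ImB abs_Im.
Qed.

Lemma continuous_scale (f : R -> R) (k t : R) :
  {for t, continuous f} -> {for t, continuous (fun u => k * f u)}.
Proof. by move=> fc; apply: cvgM => //; exact: cvg_cst. Qed.

Definition path_int g : R[i] := unit_int (Re \o g) +i* unit_int (Im \o g).

Lemma eq_path_int g h : (forall t, 0 <= t <= 1 -> g t = h t) -> path_int g = path_int h.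
Proof.
by move=> gh; congr (_ +i* _); apply: eq_unit_int => t /gh /= ->.
Qed.

Lemma path_intD g h : path_cont g -> path_cont h ->
  path_int (fun t => g t + h t) = path_int g + path_int h.
Proof.
move=> gc hc; rewrite /path_int.
rewrite (@eq_unit_int _ _ (fun t => Re (g t) + Re (h t))); last first.
  by move=> t _ /=; rewrite ReD.
rewrite [X in _ +i* X](@eq_unit_int _ _ (fun t => Im (g t) + Im (h t))); last first.
  by move=> t _ /=; rewrite ImD.
by rewrite !unit_intD//; [exact: path_cont_Im|exact: path_cont_Im|
  exact: path_cont_Re|exact: path_cont_Re].
Qed.

Lemma path_intZ c g : path_cont g -> path_int (fun t => c * g t) = c * path_int g.
Proof.
move=> gc; have gRe := path_cont_Re gc; have gIm := path_cont_Im gc.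
rewrite /path_int.
rewrite (@eq_unit_int _ _ (fun t => Re c * Re (g t) + (- Im c) * Im (g t))).
  2: by move=> t _ /=; rewrite ReM mulNr.
rewrite [X in _ +i* X](@eq_unit_int _ _ (fun t => Re c * Im (g t) + Im c * Re (g t))).
  2: by move=> t _ /=; rewrite ImM.
rewrite !unit_intD ?unit_intZ//; try (by move=> t t01; apply: continuous_scale; auto).
by case: c => x y /=; rewrite mulNr.
Qed.

Lemma path_int_cst c : path_int (fun=> c) = c.
Proof. by rewrite /path_int /comp !unit_int_cst; case: c. Qed.

(** Bounding real and imaginary parts separately costs a factor 2; only the
    order of magnitude matters below. *)
Lemma path_int_bound g (M : R) : path_cont g ->
  (forall t, 0 <= t <= 1 -> normc (g t) <= M) -> normc (path_int g) <= 2 * M.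
Proof.
move=> gc gM; rewrite (le_trans (normc_le_ReIm _))// mulr_natl mulr2n lerD//.
  apply: unit_int_bound; first exact: path_cont_Re.
  by move=> t /gM; apply: le_trans; exact: abs_Re.
apply: unit_int_bound; first exact: path_cont_Im.
by move=> t /gM; apply: le_trans; exact: abs_Im.
Qed.

Lemma path_int_half g : path_cont g ->
  path_int g = 2^-1 * (path_int (fun t => g (2^-1 * t)) +
                   path_int (fun t => g (2^-1 + 2^-1 * t))).
Proof.
move=> gc; rewrite /path_int (unit_int_half (path_cont_Re gc)) (unit_int_half (path_cont_Im gc)).
have -> : (2^-1 : R[i]) = (2^-1)%:C by rewrite fmorphV /= rmorph_nat.
by apply/eqP; rewrite eq_complex /= !mul0r subr0 addr0 !eqxx.
Qed.

Lemma path_int_rev g : path_cont g -> path_int g = path_int (fun t => g (1 - t)).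
Proof.
by move=> gc; rewrite /path_int (unit_int_rev (path_cont_Re gc)) (unit_int_rev (path_cont_Im gc)).
Qed.

(** Segments carry an arbitrary complex direction, so that triangles and
    rotated squares need no separate treatment. *)
Definition segpt p q t : R[i] := p + t%:C * (q - p).

Lemma segpt_dist p q t : 0 <= t <= 1 -> normc (segpt p q t - p) <= normc (q - p).
Proof.
move=> /andP[t0 t1]; rewrite /segpt addrAC subrr add0r normcM normc_real ger0_norm//.
by rewrite ler_piMl ?normc_ge0.
Qed.

Lemma segpt_cont p q t : {for t, continuous (segpt p q : R -> cplx R)}.
Proof.
apply/cont_pathP => e e0; pose M := normc (q - p) + 1.
have M0 : 0 < M by rewrite ltr_wpDl ?normc_ge0.
exists (e / M); first by rewrite divr_gt0.
move=> u; rewrite ltr_pdivlMr// => ut; rewrite /segpt opprD addrACA subrr add0r.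
rewrite -mulrBl -rmorphB normcM normc_real (le_lt_trans _ ut)//.
by rewrite ler_wpM2l// lerDl.
Qed.

Definition seg_cont F p q := forall t, 0 <= t <= 1 -> {for segpt p q t, continuous F}.

Lemma seg_cont_path F p q : seg_cont F p q -> path_cont (F \o segpt p q).
Proof. by move=> Fc t t01; apply: continuous_comp; [exact: segpt_cont|exact: Fc]. Qed.

Definition seg_int F p q : R[i] := (q - p) * path_int (F \o segpt p q).

Lemma eq_seg_int F G p q : (forall t, 0 <= t <= 1 -> F (segpt p q t) = G (segpt p q t)) ->
  seg_int F p q = seg_int G p q.
Proof. by move=> FG; congr (_ * _); apply: eq_path_int. Qed.

Lemma seg_intD F G p q : seg_cont F p q -> seg_cont G p q ->
  seg_int (fun z => F z + G z) p q = seg_int F p q + seg_int G p q.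
Proof.
move=> Fc Gc; rewrite /seg_int -mulrDr; congr (_ * _).
exact: path_intD (seg_cont_path Fc) (seg_cont_path Gc).
Qed.

Lemma seg_intZ c F p q : seg_cont F p q ->
  seg_int (fun z => c * F z) p q = c * seg_int F p q.
Proof.
move=> Fc; rewrite /seg_int mulrCA; congr (_ * _).
exact: path_intZ (seg_cont_path Fc).
Qed.

Lemma seg_int_cst c p q : seg_int (fun=> c) p q = c * (q - p).
Proof. by rewrite /seg_int path_int_cst mulrC. Qed.

Lemma seg_int_bound F p q (M : R) : seg_cont F p q ->
  (forall t, 0 <= t <= 1 -> normc (F (segpt p q t)) <= M) ->
  normc (seg_int F p q) <= 2 * M * normc (q - p).
Proof.
move=> Fc FM; rewrite /seg_int normcM mulrC ler_wpM2r ?normc_ge0//.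
exact: path_int_bound (seg_cont_path Fc) FM.
Qed.

Lemma segpt_rev p q t : segpt q p t = segpt p q (1 - t).
Proof. by rewrite /segpt rmorphB rmorph1; ring. Qed.

Lemma seg_int_rev F p q : seg_cont F p q -> seg_int F q p = - seg_int F p q.
Proof.
move=> Fc; rewrite /seg_int -[in RHS]mulNr opprB; congr (_ * _).
rewrite [RHS](path_int_rev (seg_cont_path Fc)); apply: eq_path_int => t _ /=.
by rewrite segpt_rev.
Qed.

Definition mid p q : R[i] := 2^-1 * (p + q).

Lemma half_real : (2^-1 : R[i]) = (2^-1 : R)%:C.
Proof. by rewrite fmorphV /= rmorph_nat. Qed.

Lemma segpt_midl p q t : segpt p (mid p q) t = segpt p q (2^-1 * t).
Proof. by rewrite /segpt /mid rmorphM /= -half_real; field. Qed.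

Lemma segpt_midr p q t : segpt (mid p q) q t = segpt p q (2^-1 + 2^-1 * t).
Proof. by rewrite /segpt /mid rmorphD rmorphM /= -half_real; field. Qed.

Lemma seg_int_half F p q : seg_cont F p q ->
  seg_int F p q = seg_int F p (mid p q) + seg_int F (mid p q) q.
Proof.
move=> Fc; rewrite /seg_int (path_int_half (seg_cont_path Fc)).
have -> : mid p q - p = (q - p) * 2^-1 by rewrite /mid; field.
have -> : q - mid p q = (q - p) * 2^-1 by rewrite /mid; field.
rewrite -!mulrA -!mulrDr; congr (_ * (_ * (_ + _))).
- by apply: eq_path_int => t _ /=; rewrite segpt_midl.
- by apply: eq_path_int => t _ /=; rewrite segpt_midr.
Qed.

Lemma seg_cont_id p q : seg_cont id p q.
Proof. by move=> t _; exact: cvg_id. Qed.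

Lemma seg_cont_cst c p q : seg_cont (fun=> c) p q.
Proof. by move=> t _; exact: (@cst_continuous (cplx R) (cplx R)). Qed.

(** The value 1/2 for the mean of t comes from the symmetry t |-> 1 - t,
    which exchanges the two ends of the segment. *)
Lemma seg_int_id p q : seg_int id p q = 2^-1 * (q ^+ 2 - p ^+ 2).
Proof.
have Ic := @seg_cont_id p q.
have : path_int (segpt p q) + path_int (segpt q p) = p + q.
  rewrite -path_intD; last 2 first.
  - by move=> t _; exact: segpt_cont.
  - by move=> t _; exact: segpt_cont.
  rewrite (@eq_path_int _ (fun=> p + q)) ?path_int_cst// => t _.
  by rewrite segpt_rev /segpt rmorphB rmorph1; ring.
have -> : path_int (segpt q p) = path_int (segpt p q).
  rewrite [RHS]path_int_rev; last by move=> t _; exact: segpt_cont.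
  by apply: eq_path_int => t _; rewrite segpt_rev.
rewrite /seg_int => H; have -> : path_int (id \o segpt p q) = 2^-1 * (p + q).
  by rewrite -H (_ : id \o segpt p q = segpt p q)//; field.
by field.
Qed.

End SegmentIntegral.

(** * Goursat's theorem for triangles *)

Section Goursat.
Variable R : realType.
Implicit Types (F G : cplx R -> cplx R) (p q r a c z : R[i]) (t e : R).
Implicit Types (U : R[i] -> Prop).

Definition is_closed U := forall z,
  (forall e, 0 < e -> exists2 w, U w & normc (w - z) < e) -> U z.

Definition is_convex U := forall p q t, U p -> U q -> 0 <= t <= 1 -> U (segpt p q t).

Lemma mid_segpt p q : mid p q = segpt p q 2^-1.
Proof. by rewrite /mid /segpt -half_real; field. Qed.

Lemma half01 : 0 <= (2^-1 : R) <= 1.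
Proof. lra. Qed.

Lemma is_convex_mid U p q : is_convex U -> U p -> U q -> U (mid p q).
Proof. by move=> cU Up Uq; rewrite mid_segpt; apply: cU => //; exact: half01. Qed.

Lemma is_convex_seg_cont U F p q : is_convex U ->
  (forall z, U z -> {for z, continuous F}) -> U p -> U q -> seg_cont F p q.
Proof. by move=> cU Fc Up Uq t t01; apply: Fc; exact: cU. Qed.

Definition tri_int F p q r : R[i] := seg_int F p q + seg_int F q r + seg_int F r p.

Definition perimeter p q r : R := normc (q - p) + normc (r - q) + normc (p - r).

(** The inner sides are each traversed twice, in opposite directions. *)
Lemma tri_int_half U F p q r : is_convex U ->
  (forall z, U z -> {for z, continuous F}) -> U p -> U q -> U r ->
  tri_int F p q r = tri_int F p (mid p q) (mid r p) + tri_int F (mid p q) q (mid q r)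
    + tri_int F (mid q r) r (mid r p) + tri_int F (mid p q) (mid q r) (mid r p).
Proof.
move=> cU Fc Up Uq Ur; have sc := is_convex_seg_cont cU Fc.
have Upq := is_convex_mid cU Up Uq; have Uqr := is_convex_mid cU Uq Ur.
have Urp := is_convex_mid cU Ur Up.
rewrite /tri_int (seg_int_half (sc _ _ Up Uq)) (seg_int_half (sc _ _ Uq Ur)).
rewrite (seg_int_half (sc _ _ Ur Up)).
rewrite (seg_int_rev (sc _ _ Urp Upq)) (seg_int_rev (sc _ _ Upq Uqr)).
rewrite (seg_int_rev (sc _ _ Uqr Urp)).
by ring.
Qed.

Lemma normc_half z : normc (2^-1 * z) = 2^-1 * normc z.
Proof. by rewrite half_real normcM normc_real ger0_norm// invr_ge0. Qed.

Lemma normc_eq z w : z = w \/ z = - w -> normc z = normc w.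
Proof. by case=> ->//; rewrite normc_opp. Qed.

Lemma perimeter_half p q r :
  [/\ perimeter p (mid p q) (mid r p) = 2^-1 * perimeter p q r,
      perimeter (mid p q) q (mid q r) = 2^-1 * perimeter p q r,
      perimeter (mid q r) r (mid r p) = 2^-1 * perimeter p q r &
      perimeter (mid p q) (mid q r) (mid r p) = 2^-1 * perimeter p q r].
Proof.
have half2 z w : z = 2^-1 * w \/ z = - (2^-1 * w) -> normc z = 2^-1 * normc w.
  by rewrite -normc_half => /normc_eq.
split; rewrite /perimeter.
- rewrite (@half2 (mid p q - p) (q - p)); last by rewrite /mid; (left; field) || (right; field).
  rewrite (@half2 (mid r p - mid p q) (r - q)); last by rewrite /mid; (left; field) || (right; field).
  rewrite (@half2 (p - mid r p) (p - r)); last by rewrite /mid; (left; field) || (right; field).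
  by ring.
- rewrite (@half2 (q - mid p q) (q - p)); last by rewrite /mid; (left; field) || (right; field).
  rewrite (@half2 (mid q r - q) (r - q)); last by rewrite /mid; (left; field) || (right; field).
  rewrite (@half2 (mid p q - mid q r) (p - r)); last by rewrite /mid; (left; field) || (right; field).
  by ring.
- rewrite (@half2 (r - mid q r) (r - q)); last by rewrite /mid; (left; field) || (right; field).
  rewrite (@half2 (mid r p - r) (p - r)); last by rewrite /mid; (left; field) || (right; field).
  rewrite (@half2 (mid q r - mid r p) (q - p)); last by rewrite /mid; (left; field) || (right; field).
  by ring.
- rewrite (@half2 (mid q r - mid p q) (p - r)); last by rewrite /mid; (left; field) || (right; field).
  rewrite (@half2 (mid r p - mid q r) (q - p)); last by rewrite /mid; (left; field) || (right; field).
  rewrite (@half2 (mid p q - mid r p) (r - q)); last by rewrite /mid; (left; field) || (right; field).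
  by ring.
Qed.

Lemma perimeter_ge0 p q r : 0 <= perimeter p q r.
Proof. by rewrite !addr_ge0 ?normc_ge0. Qed.

Lemma mid_dist p q : normc (mid p q - p) = 2^-1 * normc (q - p).
Proof. by rewrite -normc_half; congr normc; rewrite /mid; field. Qed.

Lemma mid_distr p q : normc (mid p q - q) = 2^-1 * normc (q - p).
Proof. by rewrite -normc_half normc_distC; congr normc; rewrite /mid; field. Qed.

(** Among the four halves of a triangle, one carries at least a quarter of the
    integral. *)
Lemma tri_int_bisect U F p q r : is_convex U ->
  (forall z, U z -> {for z, continuous F}) -> U p -> U q -> U r ->
  exists x : R[i] * R[i] * R[i],
   [/\ [/\ U x.1.1, U x.1.2 & U x.2],
       perimeter x.1.1 x.1.2 x.2 = 2^-1 * perimeter p q r,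
       normc (x.1.1 - p) <= perimeter p q r &
       normc (tri_int F p q r) <= 4 * normc (tri_int F x.1.1 x.1.2 x.2)].
Proof.
move=> cU Fc Up Uq Ur.
have Upq := is_convex_mid cU Up Uq; have Uqr := is_convex_mid cU Uq Ur.
have Urp := is_convex_mid cU Ur Up.
have [h1 h2 h3 h4] := perimeter_half p q r.
have := tri_int_half cU Fc Up Uq Ur.
set A := tri_int F p (mid p q) _; set B := tri_int F _ q (mid q r).
set C := tri_int F _ r _; set D := tri_int F _ (mid q r) _ => E.
pose M := normc (tri_int F p q r).
have HM : M <= normc A + normc B + normc C + normc D.
  have h5 := normcD (A + B + C) D; have h6 := normcD (A + B) C.
  have h7 := normcD A B; rewrite /M E. lra.
have pe : normc (mid p q - p) <= perimeter p q r.
  rewrite mid_dist /perimeter; have := normc_ge0 (q - p); have := normc_ge0 (r - q).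
  have := normc_ge0 (p - r); lra.
have pe2 : normc (mid q r - p) <= perimeter p q r.
  apply: (le_trans (normc_dist_tri q _ _)).
  rewrite mid_dist /perimeter; have := normc_ge0 (q - p); have := normc_ge0 (r - q).
  have := normc_ge0 (p - r); lra.
have [HA|HA] := leP M (4 * normc A).
  by exists (p, mid p q, mid r p); split => //=; rewrite subrr normc0 perimeter_ge0.
have [HB|HB] := leP M (4 * normc B).
  by exists (mid p q, q, mid q r); split.
have [HC|HC] := leP M (4 * normc C).
  by exists (mid q r, r, mid r p); split.
exists (mid p q, mid q r, mid r p); split => //=.
by rewrite -/D -/M; lra.
Qed.

(** The sequences u_n - 2M/2^n and u_n + 2M/2^n are monotone and bracket the
    limit, which is therefore a supremum. *)
Lemma dyadic_limit (u : nat -> R) (M : R) :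
  (forall n, `|u n.+1 - u n| <= M * 2^-1 ^+ n) ->
  exists l, forall n, `|u n - l| <= 2 * M * 2^-1 ^+ n.
Proof.
move=> H; pose b n := 2 * M * 2^-1 ^+ n.
have bS n : b n.+1 = b n - M * 2^-1 ^+ n by rewrite /b exprS; lra.
have up m k : u m - b m <= u (m + k)%N - b (m + k)%N.
  elim: k => [|k IH]; first by rewrite addn0.
  apply: (le_trans IH); rewrite addnS bS.
  by have := H (m + k)%N; rewrite ler_norml => /andP[]; lra.
have dn m k : u (m + k)%N + b (m + k)%N <= u m + b m.
  elim: k => [|k IH]; first by rewrite addn0.
  apply: le_trans IH; rewrite addnS bS.
  by have := H (m + k)%N; rewrite ler_norml => /andP[]; lra.
have M0 : 0 <= M by have := H 0%N; rewrite expr0 mulr1; exact: le_trans.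
have b0 n : 0 <= b n by rewrite !mulr_ge0// exprn_ge0// invr_ge0.
have ab m n : u m - b m <= u n + b n.
  have [mn|/ltnW nm] := leqP m n.
    rewrite -(subnKC mn); apply: (le_trans (up m (n - m)%N)).
    by have := b0 (m + (n - m))%N; lra.
  rewrite -(subnKC nm); apply: le_trans (dn n (m - n)%N).
  by have := b0 (n + (m - n))%N; lra.
pose E := [set x | exists n, x = u n - b n].
have hs : has_sup E.
  split; first by exists (u 0%N - b 0%N); exists 0%N.
  by exists (u 0%N + b 0%N) => x [n ->].
exists (sup E) => n; rewrite -/(b n) ler_norml; apply/andP; split.
  have : sup E <= u n + b n by apply: ge_sup; [case: hs|move=> x [m ->]].
  by lra.
have : u n - b n <= sup E by apply: ub_le_sup; [case: hs|exists n].
by lra.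
Qed.

Lemma dyadic_limitc (u : nat -> R[i]) (M : R) :
  (forall n, normc (u n.+1 - u n) <= M * 2^-1 ^+ n) ->
  exists l, forall n, normc (u n - l) <= 4 * M * 2^-1 ^+ n.
Proof.
move=> H.
have [x Hx] : exists l, forall n, `|Re (u n) - l| <= 2 * M * 2^-1 ^+ n.
  by apply: dyadic_limit => n; rewrite -ReB (le_trans (abs_Re _)).
have [y Hy] : exists l, forall n, `|Im (u n) - l| <= 2 * M * 2^-1 ^+ n.
  by apply: dyadic_limit => n; rewrite -ImB (le_trans (abs_Im _)).
exists (x +i* y) => n; rewrite (le_trans (normc_le_ReIm _))// ReB ImB /=.
by have := Hx n; have := Hy n; lra.
Qed.

Lemma small_pow (M e : R) : 0 < e -> exists n, M * 2^-1 ^+ n < e.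
Proof.
move=> e0; pose N := Num.bound `|M / e|.
have HN : M / e < N%:R by rewrite (le_lt_trans (ler_norm _))// archi_boundP.
exists N.
have H2 : N%:R < 2 ^+ N :> R by rewrite -natrX ltr_nat ltn_expl.
rewrite exprVn ltr_pdivrMr ?exprn_gt0// mulrC -ltr_pdivrMr//.
exact: lt_trans H2.
Qed.

Lemma tri_intD F G p q r :
  seg_cont F p q -> seg_cont F q r -> seg_cont F r p ->
  seg_cont G p q -> seg_cont G q r -> seg_cont G r p ->
  tri_int (fun z => F z + G z) p q r = tri_int F p q r + tri_int G p q r.
Proof. by move=> *; rewrite /tri_int !seg_intD//; ring. Qed.

Lemma affine_cont (c l : cplx R) z : {for z, continuous (fun x : cplx R => c + l * x : cplx R)}.
Proof.
apply: (@continuousD _ (cplx R) (cplx R) (fun=> c) (fun x => l * x)).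
  exact: (@cst_continuous (cplx R) (cplx R)).
exact: (@mulrl_continuous R[i] l).
Qed.

Lemma tri_int_affine c l p q r : tri_int (fun z => c + l * z) p q r = 0.
Proof.
have sc x y : seg_cont (fun=> c) x y by exact: seg_cont_cst.
have si (x y : R[i]) : seg_cont (@id (cplx R)) x y by exact: seg_cont_id.
have sl x y : seg_cont (fun z : cplx R => l * z : cplx R) x y.
  by move=> t _; exact: (@mulrl_continuous R[i] l).
rewrite tri_intD// /tri_int !seg_int_cst.
by rewrite !(seg_intZ l (si _ _)) !seg_int_id; field.
Qed.

Lemma tri_int_bound F p q r (M : R) :
  seg_cont F p q -> seg_cont F q r -> seg_cont F r p ->
  (forall t, 0 <= t <= 1 -> normc (F (segpt p q t)) <= M) ->
  (forall t, 0 <= t <= 1 -> normc (F (segpt q r t)) <= M) ->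
  (forall t, 0 <= t <= 1 -> normc (F (segpt r p t)) <= M) ->
  normc (tri_int F p q r) <= 2 * M * perimeter p q r.
Proof.
move=> c1 c2 c3 b1 b2 b3; rewrite /tri_int /perimeter !mulrDr.
by rewrite (le_trans (normcD _ _))// lerD ?(le_trans (normcD _ _))// ?lerD//;
  exact: seg_int_bound.
Qed.

Lemma triangle_diameter p q r t : 0 <= t <= 1 ->
  [/\ normc (segpt p q t - p) <= perimeter p q r,
      normc (segpt q r t - p) <= perimeter p q r &
      normc (segpt r p t - p) <= perimeter p q r].
Proof.
move=> t01; have h1 := normc_ge0 (q - p); have h2 := normc_ge0 (r - q).
have h3 := normc_ge0 (p - r); rewrite /perimeter; split.
- by have := segpt_dist p q t01; lra.
- by have h4 := segpt_dist q r t01; have h5 := normc_dist_tri q (segpt q r t) p; lra.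
- have t01' : 0 <= 1 - t <= 1 by lra.
  have := segpt_dist p r t01'; rewrite -segpt_rev (normc_distC r p); lra.
Qed.

(** Bisect towards a point z0.  There F is affine up to o(|z - z0|), affine
    functions have zero integral, and the remainder over a triangle of perimeter
    s is o(s^2), whereas the chosen n-th triangle has perimeter L/2^n and carries
    at least 4^{-n} of the integral. *)
Lemma goursat U F p q r : is_closed U -> is_convex U ->
  (forall z, U z -> derivable F z 1) -> U p -> U q -> U r ->
  tri_int F p q r = 0.
Proof.
move=> clU cU dF Up Uq Ur.
have Fc z : U z -> {for z, continuous F} by move=> /dF /derivable_cont.
pose T := (R[i] * R[i] * R[i])%type.
pose inU (x : T) := [/\ U x.1.1, U x.1.2 & U x.2].
pose P (x : T) := perimeter x.1.1 x.1.2 x.2.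
pose N (x : T) := normc (tri_int F x.1.1 x.1.2 x.2).
have /choice[nxt nxtP] : forall x : T, exists y : T, inU x ->
    [/\ inU y, P y = 2^-1 * P x,
      normc (y.1.1 - x.1.1) <= P x & N x <= 4 * N y].
  move=> x.
  have [[U1 U2 U3]|nU] := pselect (inU x); last by exists x.
  by have [y yP] := tri_int_bisect cU Fc U1 U2 U3; exists y.
pose x n := iter n nxt (p, q, r).
have xU n : inU (x n) by elim: n => [|n IH]; [split|case: (nxtP _ IH)].
pose L := perimeter p q r.
have xP n : P (x n) = L * 2^-1 ^+ n.
  elim: n => [|n IH]; first by rewrite expr0 mulr1.
  by case: (nxtP _ (xU n)) => _ -> _ _; rewrite IH exprS mulrCA.
have xN n : N (x 0%N) <= 4 ^+ n * N (x n).
  elim: n => [|n IH]; first by rewrite expr0 mul1r.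
  rewrite (le_trans IH)// exprSr -mulrA ler_wpM2l ?exprn_ge0//.
  by case: (nxtP _ (xU n)).
have [z0 Hz] : exists l, forall n, normc ((x n).1.1 - l) <= 4 * L * 2^-1 ^+ n.
  apply: dyadic_limitc => n; rewrite -xP.
  by case: (nxtP _ (xU n)).
have L0 : 0 <= L by exact: perimeter_ge0.
have Uz : U z0.
  apply: clU => e e0; have [n Hn] := small_pow (4 * L) e0.
  by exists (x n).1.1; [case: (xU n)|exact: le_lt_trans Hn].
have [l Hl] := (derivcP F z0).1 (dF _ Uz).
apply/eqP; rewrite -normc_eq0 eq_le normc_ge0 andbT.
rewrite -/(N (x 0%N)).
apply/ler_addgt0Pr => e e0; rewrite add0r.
(* 10 L^2 e' bounds the integral; the 1 covers the case L = 0 *)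
pose e' := e / (10 * L ^+ 2 + 1).
have D0 : 0 < 10 * L ^+ 2 + 1 by rewrite ltr_wpDl// mulr_ge0// sqr_ge0.
have e'0 : 0 < e' by rewrite divr_gt0.
have [d d0 dH] := Hl e' e'0.
have [n Hn] := small_pow (5 * L) d0.
have [U1 U2 U3] := xU n.
pose p' := (x n).1.1; pose q' := (x n).1.2; pose r' := (x n).2.
pose s := L * 2^-1 ^+ n.
have s0 : 0 <= s by rewrite mulr_ge0// exprn_ge0// invr_ge0.
pose A (z : cplx R) : cplx R := (l * z0 - F z0) + (- l) * z.
pose G (z : cplx R) : cplx R := F z + A z.
have Gc z : U z -> {for z, continuous G}.
  move=> Uz'; apply: (@continuousD _ (cplx R) (cplx R) F); first exact: Fc.
  exact: affine_cont.
(* the triangle has diameter at most s, and its first vertex is 4s-close to z0 *)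
have close z : normc (z - p') <= s -> normc (G z) <= e' * (5 * s).
  move=> zp; have zz0 : normc (z - z0) <= 5 * s.
    have := normc_dist_tri p' z z0; have := Hz n; rewrite -/p' -mulrA -/s; lra.
  have -> : G z = F z - F z0 - l * (z - z0) by rewrite /G /A; ring.
  rewrite (le_trans (dH _ _))//.
    by rewrite (le_lt_trans zz0)// /s mulrA.
  by rewrite ler_wpM2l// ltW.
have Ps : perimeter p' q' r' = s by rewrite /s -xP.
have HG : normc (tri_int G p' q' r') <= 2 * (e' * (5 * s)) * s.
  rewrite -{2}Ps; apply: tri_int_bound; try exact: (is_convex_seg_cont cU Gc).
  - by move=> t /(triangle_diameter p' q' r') [H1 H2 H3]; apply: close; rewrite -Ps.
  - by move=> t /(triangle_diameter p' q' r') [H1 H2 H3]; apply: close; rewrite -Ps.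
  - by move=> t /(triangle_diameter p' q' r') [H1 H2 H3]; apply: close; rewrite -Ps.
have E : tri_int G p' q' r' = tri_int F p' q' r'.
  have sF u v : U u -> U v -> seg_cont F u v by exact: is_convex_seg_cont.
  have sA u v : seg_cont A u v by move=> t _; exact: affine_cont.
  by rewrite (tri_intD (F := F) (G := A)) ?tri_int_affine ?addr0//; exact: sF.
rewrite (le_trans (xN n))//.
have -> : e = e' * (10 * L ^+ 2 + 1) by rewrite /e' divfK// gt_eqF.
have : N (x n) <= e' * 10 * L ^+ 2 * (2^-1 ^+ n) ^+ 2.
  by rewrite /N -E (le_trans HG)// /s le_eqVlt; apply/orP; left; apply/eqP; ring.
have -> : 4 ^+ n = ((2^-1 ^+ n) ^+ 2)^-1 :> R.
  by rewrite exprVn expr2 -invfM invrK -exprMn -natrM.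
move=> H; rewrite mulrC ler_pdivrMr ?exprn_gt0 ?invr_gt0//.
by apply: (le_trans H); rewrite ler_wpM2r ?sqr_ge0// -mulrA ler_pM2l// lerDl.
Qed.

End Goursat.

(** * Triangles with an exceptional vertex *)

Section Cauchy.
Variable R : realType.
Implicit Types (F G f : cplx R -> cplx R) (p q r a b c z w m : R[i]) (t e : R).
Implicit Types (U V : R[i] -> Prop).

Lemma is_closedI U V : is_closed U -> is_closed V -> is_closed (fun z => U z /\ V z).
Proof.
move=> cU cV z H; split; [apply: cU|apply: cV] => e /H[w [Uw Vw] wz].
  by exists w.
by exists w.
Qed.

Lemma is_convexI U V : is_convex U -> is_convex V -> is_convex (fun z => U z /\ V z).
Proof. by move=> cU cV p q t [Up Vp] [Uq Vq] t01; split; [exact: cU|exact: cV]. Qed.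

Definition halfplane m a (k : R) z : Prop := k <= Re (m * (z - a)).

Lemma Re_le z : Re z <= normc z.
Proof. by rewrite (le_trans (ler_norm _))// abs_Re. Qed.

Lemma ReZ (k : R) z : Re (k%:C * z) = k * Re z.
Proof. by rewrite ReM /= mul0r subr0. Qed.

Lemma halfplane_closed m a k : is_closed (halfplane m a k).
Proof.
move=> z H; rewrite /halfplane; apply/ler_addgt0Pr => e e0.
pose M := normc m + 1; have M0 : 0 < M by rewrite ltr_wpDl ?normc_ge0.
have [|w Uw wz] := H (e / M); first by rewrite divr_gt0.
apply: (le_trans Uw).
have -> : m * (w - a) = m * (z - a) + m * (w - z) by ring.
rewrite ReD lerD2l (le_trans (Re_le _))// normcM.
move: wz; rewrite ltr_pdivlMr// => /ltW; apply: le_trans.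
by rewrite mulrC ler_wpM2l ?normc_ge0// lerDl.
Qed.

Lemma halfplane_convex m a k : is_convex (halfplane m a k).
Proof.
move=> p q t; rewrite /halfplane => Up Uq /andP[t0 t1].
have -> : m * (segpt p q t - a) = m * (p - a) + t%:C * (m * (q - a) - m * (p - a)).
  by rewrite /segpt; ring.
by rewrite ReD ReZ ReB; nra.
Qed.

Definition disc a (k : R) z : Prop := normc (z - a) <= k.

Lemma disc_closed a k : is_closed (disc a k).
Proof.
move=> z H; rewrite /disc; apply/ler_addgt0Pr => e /H[w Uw wz].
have h := normc_dist_tri w z a; rewrite (normc_distC z w) in h.
rewrite (le_trans h)// addrC lerD//; exact: ltW.
Qed.

Lemma disc_convex a k : is_convex (disc a k).
Proof.
move=> p q t; rewrite /disc => Up Uq /andP[t0 t1].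
have -> : segpt p q t - a = (1 - t)%:C * (p - a) + t%:C * (q - a).
  by rewrite /segpt rmorphB rmorph1; ring.
rewrite (le_trans (normcD _ _))// !normcM !normc_real !ger0_norm ?subr_ge0//.
nra.
Qed.

(** Of the four halves of the triangle only one touches a; the other three
    lie in a half-plane that avoids a, where Goursat's theorem applies.  The
    hypotheses on m say that q and r lie strictly on one side of a line
    through a. *)
Lemma goursat_vertex_shrink U F a q r m :
  is_closed U -> is_convex U -> (forall z, U z -> {for z, continuous F}) ->
  (forall z, U z -> z != a -> derivable F z 1) -> U a -> U q -> U r ->
  0 < Re (m * (q - a)) -> 0 < Re (m * (r - a)) ->
  tri_int F a q r = tri_int F a (mid a q) (mid r a).
Proof.
move=> clU cU Fc dF Ua Uq Ur q0 r0.
have Uaq := is_convex_mid cU Ua Uq; have Uqr := is_convex_mid cU Uq Ur.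
have Ura := is_convex_mid cU Ur Ua.
rewrite (tri_int_half cU Fc Ua Uq Ur).
pose k := 2^-1 * Num.min (Re (m * (q - a))) (Re (m * (r - a))).
have kq : k <= 2^-1 * Re (m * (q - a)) by rewrite ler_pM2l ?invr_gt0// ge_min lexx.
have kr : k <= 2^-1 * Re (m * (r - a)).
  by rewrite ler_pM2l ?invr_gt0// ge_min lexx orbT.
have k0 : 0 < k by rewrite mulr_gt0 ?invr_gt0// lt_min q0 r0.
pose V z := U z /\ halfplane m a k z.
have clV : is_closed V by apply: is_closedI => //; exact: halfplane_closed.
have cV : is_convex V by apply: is_convexI => //; exact: halfplane_convex.
have dV z : V z -> derivable F z 1.
  move=> [Uz Hz]; apply: dF => //; apply/eqP => za; move: Hz.
  by rewrite /halfplane za subrr mulr0 /= leNgt k0.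
have hpE x y : Re (m * (mid x y - a)) =
    2^-1 * (Re (m * (x - a)) + Re (m * (y - a))).
  by rewrite -ReD -ReZ -half_real; congr Re; rewrite /mid; field.
have ma0 : Re (m * (a - a)) = 0 by rewrite subrr mulr0.
have Vq : V q by split=> //; rewrite /halfplane; lra.
have Vr : V r by split=> //; rewrite /halfplane; lra.
have Vaq : V (mid a q) by split=> //; rewrite /halfplane hpE ma0; lra.
have Vqr : V (mid q r) by split=> //; rewrite /halfplane hpE; lra.
have Vra : V (mid r a) by split=> //; rewrite /halfplane hpE ma0; lra.
by rewrite (goursat clV cV dV Vaq Vq Vqr) (goursat clV cV dV Vqr Vr Vra)
  (goursat clV cV dV Vaq Vqr Vra) !addr0.
Qed.

(** Shrinking the triangle towards a makes its integral vanish, since F is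
    bounded near a. *)
Lemma goursat_vertex U F a q r m :
  is_closed U -> is_convex U -> (forall z, U z -> {for z, continuous F}) ->
  (forall z, U z -> z != a -> derivable F z 1) -> U a -> U q -> U r ->
  0 < Re (m * (q - a)) -> 0 < Re (m * (r - a)) ->
  tri_int F a q r = 0.
Proof.
move=> clU cU Fc dF Ua Uq Ur q0 r0.
have shrink n : exists q' r', [/\ U q', U r', 0 < Re (m * (q' - a)),
    0 < Re (m * (r' - a)) & perimeter a q' r' = perimeter a q r * 2^-1 ^+ n /\
    tri_int F a q r = tri_int F a q' r'].
  elim: n => [|n [q' [r' [Uq' Ur' q'0 r'0 [pE tE]]]]].
    by exists q, r; rewrite expr0 mulr1.
  exists (mid a q'), (mid r' a).
  have hq : mid a q' - a = (2^-1)%:C * (q' - a) by rewrite -half_real /mid; field.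
  have hr : mid r' a - a = (2^-1)%:C * (r' - a) by rewrite -half_real /mid; field.
  split; rewrite ?hq ?hr; [exact: is_convex_mid|exact: is_convex_mid| | |].
  - by rewrite mulrCA ReZ mulr_gt0 ?invr_gt0.
  - by rewrite mulrCA ReZ mulr_gt0 ?invr_gt0.
  split; last by rewrite tE; exact: (goursat_vertex_shrink (m := m) clU cU).
  by have [-> _ _ _] := perimeter_half a q' r'; rewrite pE exprS mulrCA.
apply/eqP; rewrite -normc_eq0 eq_le normc_ge0 andbT.
apply/ler_addgt0Pr => e e0; rewrite add0r.
have [d d0 dH] := (contcP F a).1 (Fc _ Ua) 1 ltr01.
pose M := normc (F a) + 1; have M0 : 0 < M by rewrite ltr_wpDl ?normc_ge0.
have : 0 < Num.min d (e / (2 * M)) by rewrite lt_min d0 divr_gt0// mulr_gt0.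
move=> /(small_pow (perimeter a q r))[n].
have [q' [r' [Uq' Ur' q'0 r'0 [<- ->]]]] := shrink n.
rewrite lt_min ltr_pdivlMr ?mulr_gt0// mulrC => /andP[nd /ltW ne].
apply: le_trans ne.
have sc := is_convex_seg_cont cU Fc.
have near z : normc (z - a) <= perimeter a q' r' -> normc (F z) <= M.
  move=> za; have /dH/ltW h1 : normc (z - a) < d by exact: le_lt_trans nd.
  have := normcD (F z - F a) (F a); rewrite subrK /M; lra.
by apply: tri_int_bound; try exact: sc; move=> t /(triangle_diameter a q' r')[? ? ?];
  exact: near.
Qed.

End Cauchy.

(** * Integrals around a square *)

Section Diamond.
Variable R : realType.
Implicit Types (F G f : cplx R -> cplx R) (p q r a b c z w m : R[i]) (t e : R).

Lemma derivc_sub f a z : derivable f z 1 ->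
  derivable (fun w : cplx R => f w - a : cplx R) z 1.
Proof.
move=> df; apply: (@derivableB R[i] (cplx R) (cplx R) f (cst a) z 1 df).
exact: (@derivable_cst R[i] (cplx R) (cplx R)).
Qed.

Lemma derivc_inv f z : f z != 0 -> derivable f z 1 ->
  derivable (fun w : cplx R => (f w)^-1 : cplx R) z 1.
Proof. exact: (@derivableV R[i] (cplx R)). Qed.

Lemma derivc_mul F G z : derivable F z 1 -> derivable G z 1 ->
  derivable (fun w : cplx R => F w * G w : cplx R) z 1.
Proof. exact: (@derivableM R[i] (cplx R)). Qed.

Lemma derivc_id z : derivable (fun w : cplx R => w) z 1.
Proof. exact: derivable_id. Qed.

Lemma derivc_invB a z : z != a ->
  derivable (fun w : cplx R => (w - a)^-1 : cplx R) z 1.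
Proof.
move=> za; apply: (@derivc_inv (fun w => w - a)); first by rewrite subr_eq0.
by apply: (@derivc_sub id); exact: derivc_id.
Qed.

Lemma derivc_quot f a b z : z != a -> derivable f z 1 ->
  derivable (fun w : cplx R => (f w - b) / (w - a) : cplx R) z 1.
Proof.
move=> za df; apply: (@derivc_mul (fun w => f w - b)); first exact: derivc_sub.
exact: derivc_invB.
Qed.

Lemma cyclic_telescope (h : nat -> R[i]) :
  h 4 = h 0%N -> \sum_(k < 4) (h k.+1 - h k) = 0.
Proof.
by move=> h4; rewrite -(big_mkord xpredT (fun k => h k.+1 - h k)) telescope_sumr// h4 subrr.
Qed.

Definition imag : R[i] := Complex 0 1.

Lemma imag_sq : imag * imag = -1.
Proof. by rewrite -expr2 sqr_i. Qed.

Lemma normc_imag : normc imag = 1.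
Proof. by rewrite /= expr0n expr1n /= add0r sqrtr1. Qed.

Lemma normc_exp z n : normc (z ^+ n) = normc z ^+ n.
Proof. by elim: n => [|n IH]; rewrite ?expr0 ?normc1// !exprS normcM IH. Qed.

Variables (w0 : R[i]) (rho : R).
Hypothesis rho0 : 0 < rho.

(** The contour is the square with corners w0 + rho i^k.  Its sides are
    permuted by multiplication by i, so one computation serves all four. *)
Definition vertex k : R[i] := w0 + rho%:C * imag ^+ k.
Definition edge k t : R[i] := segpt (vertex k) (vertex k.+1) t.
Definition oint F : R[i] := \sum_(k < 4) seg_int F (vertex k) (vertex k.+1).
(** Sides have period 4 in k, so that all k may be allowed. *)
Definition edge_continuous F := forall k t, 0 <= t <= 1 -> {for edge k t, continuous F}.
(** Conjugate of an outer normal to the k-th side: Re (normal k * z) is a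
    linear form equal to rho on that side (after centring), see [edge_Re]. *)
Definition normal k : R[i] := (1 - imag) * (- imag) ^+ k.

Lemma edgeE k t : edge k t - w0 = rho%:C * imag ^+ k * (1 + t%:C * (imag - 1)).
Proof. by rewrite /edge /segpt /vertex exprS; ring. Qed.

Lemma normal_imagX k : (- imag) ^+ k * imag ^+ k = 1.
Proof. by rewrite -exprMn mulNr imag_sq opprK expr1n. Qed.

Lemma edge_Re k t : Re (normal k * (edge k t - w0)) = rho.
Proof.
have -> : normal k * (edge k t - w0) =
    rho%:C * ((- imag) ^+ k * imag ^+ k) * ((1 - imag) * (1 + t%:C * (imag - 1))).
  by rewrite edgeE /normal; ring.
rewrite normal_imagX mulr1.
have -> : (1 - imag) * (1 + t%:C * (imag - 1)) =
    (1 - imag) + t%:C * (imag + imag - 1 - imag * imag) by ring.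
by rewrite imag_sq ReZ !(ReD, ReN, ReZ, ReB) /=; ring.
Qed.

Lemma normc_normal k : normc (normal k) <= 2.
Proof.
rewrite /normal normcM normc_exp normc_opp normc_imag expr1n mulr1.
by rewrite (le_trans (normcD _ _))// normc_opp normc_imag normc1.
Qed.

Lemma vertex_edge0 k : vertex k = edge k 0.
Proof. by rewrite /edge /segpt mul0r addr0. Qed.

Lemma vertex_edge1 k : vertex k.+1 = edge k 1.
Proof. by rewrite /edge /segpt mul1r addrC subrK. Qed.

Lemma Re_normal_center k a : normc (a - w0) <= rho / 4 ->
  Re (normal k * (a - w0)) <= rho / 2.
Proof.
move=> aw; rewrite (le_trans (Re_le _))// normcM.
have h0 := normc_ge0 (a - w0); have h1 := normc_ge0 (normal k).
have h2 := normc_normal k; have : normc (normal k) * normc (a - w0) <= 2 * (rho / 4).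
  exact: ler_pM.
lra.
Qed.

Lemma edge_Re_center k t a : normc (a - w0) <= rho / 4 ->
  rho / 2 <= Re (normal k * (edge k t - a)).
Proof.
move=> /(Re_normal_center k) h; have h1 := edge_Re k t.
have -> : normal k * (edge k t - a) = normal k * (edge k t - w0) - normal k * (a - w0).
  by ring.
rewrite ReB; lra.
Qed.

(** A point within rho/4 of the centre stays at distance rho/4 from the
    contour; all kernels below are bounded thanks to this. *)
Lemma edge_far k t a : normc (a - w0) <= rho / 4 ->
  rho / 4 <= normc (edge k t - a).
Proof.
move=> /(edge_Re_center k t) h1; have h2 := Re_le (normal k * (edge k t - a)).
rewrite normcM in h2.
have h3 : normc (normal k) * normc (edge k t - a) <= 2 * normc (edge k t - a).
  by rewrite ler_wpM2r ?normc_ge0 ?normc_normal.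
lra.
Qed.

Lemma edge_neq k t a : normc (a - w0) <= rho / 4 -> edge k t != a.
Proof.
move=> /(edge_far k t) h; rewrite -subr_eq0 -normc_gt0; apply: lt_le_trans h.
by rewrite divr_gt0.
Qed.

Lemma disc_vertex k : disc w0 rho (vertex k).
Proof.
rewrite /disc /vertex addrAC subrr add0r normcM normc_real normc_exp normc_imag.
by rewrite expr1n mulr1 gtr0_norm.
Qed.

Lemma disc_edge k t : 0 <= t <= 1 -> disc w0 rho (edge k t).
Proof. by move=> t01; apply: disc_convex => //; exact: disc_vertex. Qed.

Lemma eq_oint F G : (forall k t, 0 <= t <= 1 -> F (edge k t) = G (edge k t)) ->
  oint F = oint G.
Proof. by move=> FG; apply: eq_bigr => k _; apply: eq_seg_int => t; exact: FG. Qed.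

Lemma ointD F G : edge_continuous F -> edge_continuous G ->
  oint (fun z => F z + G z) = oint F + oint G.
Proof.
move=> Fc Gc; rewrite /oint -big_split; apply: eq_bigr => k _.
by apply: seg_intD; [exact: Fc|exact: Gc].
Qed.

Lemma ointZ c F : edge_continuous F -> oint (fun z => c * F z) = c * oint F.
Proof.
move=> Fc; rewrite /oint mulr_sumr; apply: eq_bigr => k _.
by apply: seg_intZ; exact: Fc.
Qed.

Lemma ointB F G : edge_continuous F -> edge_continuous G ->
  oint (fun z => F z - G z) = oint F - oint G.
Proof.
move=> Fc Gc.
have Gc' : edge_continuous (fun z => -1 * G z).
  move=> k t t01; apply: (@continuousM R[i] (cplx R) (fun=> -1)); last exact: Gc.
  exact: (@cst_continuous (cplx R) (cplx R)).
rewrite (eq_oint (G := fun z => F z + (-1) * G z)); last first.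
  by move=> k t _; rewrite mulN1r.
by rewrite (ointD Fc Gc') ointZ// mulN1r.
Qed.

Lemma side_len k : normc (vertex k.+1 - vertex k) <= 2 * rho.
Proof.
have -> : vertex k.+1 - vertex k = (vertex k.+1 - w0) + (w0 - vertex k) by ring.
rewrite (le_trans (normcD _ _))// (normc_distC w0).
have := disc_vertex k; have := disc_vertex k.+1; rewrite /disc; lra.
Qed.

Lemma oint_bound F (M : R) : edge_continuous F ->
  (forall k t, (k < 4)%N -> 0 <= t <= 1 -> normc (F (edge k t)) <= M) ->
  normc (oint F) <= 16 * rho * M.
Proof.
move=> Fc FM; have M0 : 0 <= M.
  by apply: le_trans (FM 0%N 0 _ _); rewrite ?normc_ge0 ?lexx ?ler01.
have sb k : (k < 4)%N -> normc (seg_int F (vertex k) (vertex k.+1)) <= 4 * rho * M.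
  move=> k4; rewrite (le_trans (seg_int_bound (Fc k) (fun t => FM k t k4)))//.
  have := side_len k; have := normc_ge0 (vertex k.+1 - vertex k); nra.
rewrite /oint !big_ord_recr big_ord0 /= add0r.
have h0 := sb 0%N isT; have h1 := sb 1%N isT; have h2 := sb 2%N isT.
have h3 := sb 3%N isT.
move: (seg_int F _ _) (seg_int F _ _) (seg_int F _ _) (seg_int F _ _) h0 h1 h2 h3.
move=> s3 s2 s1 s0 h3 h2 h1 h0; clear sb FM Fc.
have e1 := normcD (s0 + s1 + s2) s3; have e2 := normcD (s0 + s1) s2.
have e3 := normcD s0 s1; lra.
Qed.

Lemma vertex4 : vertex 4 = vertex 0.
Proof.
by rewrite /vertex expr0 (_ : imag ^+ 4 = 1)// (exprM imag 2 2) expr2 sqr_i mulrNN mulr1.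
Qed.

(** Cut the square into triangles with common vertex a; the inner sides
    telescope. *)
Lemma oint_star F a : disc w0 rho a ->
  (forall z, disc w0 rho z -> {for z, continuous F}) ->
  (forall k, tri_int F a (vertex k) (vertex k.+1) = 0) -> oint F = 0.
Proof.
move=> Da Fc T0.
have sc p q : disc w0 rho p -> disc w0 rho q -> seg_cont F p q.
  exact: (is_convex_seg_cont (@disc_convex _ _ _) Fc).
have E k : seg_int F (vertex k) (vertex k.+1) = seg_int F a (vertex k.+1) - seg_int F a (vertex k).
  have := T0 k; rewrite /tri_int (seg_int_rev (sc _ _ Da (disc_vertex k.+1))) => H.
  by apply/eqP; rewrite -subr_eq0 -H; apply/eqP; ring.
rewrite /oint; under eq_bigr do rewrite E.
by rewrite (cyclic_telescope (h := fun k => seg_int F a (vertex k)))// vertex4.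
Qed.

(** Cauchy's theorem with one exceptional point, as needed for difference
    quotients. *)
Lemma cauchy_diamond F a : normc (a - w0) <= rho / 4 ->
  (forall z, disc w0 rho z -> {for z, continuous F}) ->
  (forall z, disc w0 rho z -> z != a -> derivable F z 1) -> oint F = 0.
Proof.
move=> aw Fc dF.
have Da : disc w0 rho a by apply: (le_trans aw); have := rho0; lra.
apply: (oint_star Da Fc) => k.
have pos x t : x = edge k t -> 0 < Re (normal k * (x - a)).
  by move=> ->; apply: lt_le_trans (edge_Re_center k t aw); rewrite divr_gt0.
apply: (goursat_vertex (m := normal k) (@disc_closed _ w0 rho) (@disc_convex _ w0 rho)) => //.
- exact: disc_vertex.
- exact: disc_vertex.
- exact: pos (vertex_edge0 k).
- exact: pos (vertex_edge1 k).
Qed.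

End Diamond.

(** * Cauchy's integral formula *)

Section CauchyFormula.
Variable R : realType.
Implicit Types (F G f : cplx R -> cplx R) (p q r a b c z w m : R[i]) (t e : R).

Definition inversion : cplx R -> cplx R := fun z => z^-1.

Lemma inversion_cont z : z != 0 -> {for z, continuous inversion}.
Proof.
by move=> z0; apply: derivable_cont; exact: (@derivc_inv _ id).
Qed.

Lemma invB_cont a z : z != a -> {for z, continuous (fun w : cplx R => (w - a)^-1 : cplx R)}.
Proof. by move=> za; apply/derivable_cont/derivc_invB. Qed.

Lemma seg_int_shift F a p q : seg_int (fun z => F (z - a)) p q = seg_int F (p - a) (q - a).
Proof.
rewrite /seg_int opprB addrA subrK; congr (_ * _).
by apply: eq_path_int => t _ /=; congr F; rewrite /segpt; ring.
Qed.

(** The integral of dz / z around the square, that is 2 pi i; each side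
    contributes the same amount. *)
Definition kappa : R[i] := 4 * path_int (fun t => (imag R - 1) / (1 + t%:C * (imag R - 1))).

(** The imaginary part of the integrand is 1 / ((1-t)^2 + t^2) >= 1. *)
Lemma kappa_neq0 : kappa != 0.
Proof.
rewrite /kappa mulf_neq0 ?pnatr_eq0//; apply/eqP => /(congr1 Im) /=.
set g := (X in unit_int X); have gE t : g t = ((1 - t) ^+ 2 + t ^+ 2)^-1.
  change (Im ((imag R - 1) / (1 + t%:C * (imag R - 1))) = ((1 - t) ^+ 2 + t ^+ 2)^-1).
  have -> : 1 + t%:C * (imag R - 1) = Complex (1 - t) t.
    by apply/eqP; rewrite eq_complex /=; apply/andP; split; apply/eqP; ring.
  by rewrite ImM ReB ImB /=; field; apply/eqP; nra.
have uc : forall t, 0 <= t <= 1 -> {for t, continuous g}.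
  apply: (@path_cont_Im _ (fun t => (imag R - 1) / (1 + t%:C * (imag R - 1)))) => t t01.
  apply: (@continuousM R[i] _ (fun=> imag R - 1) (fun t : R => (1 + t%:C * (imag R - 1))^-1 : cplx R)).
    exact: (@cst_continuous R (cplx R)).
  apply: (@continuous_comp _ _ _ (segpt 1 (imag R) : R -> cplx R) inversion); first exact: segpt_cont.
  apply: inversion_cont; have := @edge_neq R 0 1 ltr01 0 t 0.
  by rewrite /edge /vertex !add0r !mul1r expr0 expr1 oppr0 normc0; apply; rewrite invr_ge0.
apply/eqP; rewrite gt_eqF// (lt_le_trans ltr01)// -[leLHS](@unit_int_cst R).
apply: le_unit_int => //; first by move=> t _; exact: cvg_cst.
move=> t /andP[t0 t1]; rewrite gE invf_ge1; nra.
Qed.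

Variables (w0 : R[i]) (rho : R).
Hypothesis rho0 : 0 < rho.

Lemma edge_cont_invB a : normc (a - w0) <= rho / 4 ->
  edge_continuous w0 rho (fun z : cplx R => (z - a)^-1 : cplx R).
Proof. by move=> aw k t t01; apply: invB_cont; exact: edge_neq. Qed.

Lemma center_inner : normc (w0 - w0) <= rho / 4.
Proof. by rewrite subrr normc0 divr_ge0// ltW. Qed.

Lemma oint_inv_center : oint w0 rho (fun z => (z - w0)^-1) = kappa.
Proof.
have H k : seg_int (fun z => (z - w0)^-1) (vertex w0 rho k) (vertex w0 rho k.+1) =
    path_int (fun t => (imag R - 1) / (1 + t%:C * (imag R - 1))).
  rewrite /seg_int -path_intZ; last first.
    apply: (@seg_cont_path _ (fun z => (z - w0)^-1)) => t.
    exact: (edge_cont_invB center_inner).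
  apply: eq_path_int => t t01 /=; rewrite -/(edge w0 rho k t) edgeE.
  have -> : vertex w0 rho k.+1 - vertex w0 rho k = rho%:C * imag R ^+ k * (imag R - 1).
    by rewrite /vertex exprS; ring.
  rewrite invfM mulrACA mulfV ?mul1r//.
  rewrite -normc_eq0 normcM normc_real normc_exp normc_imag expr1n mulr1.
  by rewrite gtr0_norm// gt_eqF.
by rewrite /oint !big_ord_recr big_ord0 /= !H /kappa; ring.
Qed.

(** Translate the pole to the origin: the square moves by w0 - a, and each of
    its sides sweeps out a parallelogram contained in a half-plane that avoids
    the origin.  Goursat's theorem on the two halves of each parallelogram shows
    that the contributions of the sides change by a telescoping amount. *)
Lemma oint_inv a : normc (a - w0) <= rho / 4 ->
  oint w0 rho (fun z => (z - a)^-1) = kappa.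
Proof.
move=> aw; rewrite -oint_inv_center.
pose h k := seg_int inversion (vertex w0 rho k - w0) (vertex w0 rho k - a).
have E k : seg_int (fun z => (z - a)^-1) (vertex w0 rho k) (vertex w0 rho k.+1) =
   seg_int (fun z => (z - w0)^-1) (vertex w0 rho k) (vertex w0 rho k.+1) + (h k.+1 - h k).
  rewrite (seg_int_shift inversion) (seg_int_shift inversion) /h.
  pose U := halfplane (normal R k) 0 (rho / 2).
  have clU : is_closed U by exact: halfplane_closed.
  have cU : is_convex U by exact: halfplane_convex.
  have nz z : U z -> z != 0.
    move=> Uz; apply/eqP => z0; move: Uz; rewrite /U /halfplane z0 subrr mulr0 /=.
    by rewrite leNgt divr_gt0.
  have dU z : U z -> derivable inversion z 1.
    by move=> /nz z0; exact: (@derivc_inv _ id).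
  have cc z : U z -> {for z, continuous inversion} by move=> /nz; exact: inversion_cont.
  have sc p q : U p -> U q -> seg_cont inversion p q by exact: (is_convex_seg_cont cU cc).
  have Ue t b : normc (b - w0) <= rho / 4 -> U (edge w0 rho k t - b).
    by move=> bw; rewrite /U /halfplane subr0; exact: edge_Re_center.
  have := Ue 0 _ center_inner; have := Ue 1 _ center_inner; have := Ue 0 _ aw; have := Ue 1 _ aw.
  rewrite -vertex_edge0 -vertex_edge1.
  set P := vertex w0 rho k - w0; set Q := vertex w0 rho k.+1 - w0.
  set P' := vertex w0 rho k - a; set Q' := vertex w0 rho k.+1 - a.
  move=> UQ' UP' UQ UP.
  have := goursat clU cU dU UP UQ UQ'; have := goursat clU cU dU UP UQ' UP'.
  rewrite /tri_int (seg_int_rev (sc _ _ UP UQ')) (seg_int_rev (sc _ _ UP' UQ')).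
  rewrite (seg_int_rev (sc _ _ UP UP')) => h1 h2.
  have h1' : seg_int inversion P Q' = seg_int inversion P' Q' + seg_int inversion P P'.
    by apply/eqP; rewrite -subr_eq0 -h1; apply/eqP; ring.
  have -> : seg_int inversion P Q = seg_int inversion P Q' - seg_int inversion Q Q'.
    by apply/eqP; rewrite -subr_eq0 -h2; apply/eqP; ring.
  by rewrite h1'; ring.
have h4 : h 4 = h 0%N by rewrite /h vertex4.
rewrite /oint; under eq_bigr do rewrite E.
by rewrite big_split /= cyclic_telescope// addr0.
Qed.

(** The difference quotient with its value at a filled in.  It is continuous
    at a, but not known to be differentiable there. *)
Definition dquot f a l : cplx R -> cplx R :=
  fun z => if z == a then l else (f z - f a) / (z - a).

Lemma dquot_cont f a : derivable f a 1 ->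
  exists l, {for a, continuous (dquot f a l)}.
Proof.
move=> /derivcP[l H]; exists l; apply/contcP => e e0.
have [|d d0 dH] := H (e / 2); first by rewrite divr_gt0.
exists d => // w /dH; rewrite /dquot eqxx.
have [->|wa] := eqVneq w a; first by move=> _; rewrite subrr normc0.
have wa0 : w - a != 0 by rewrite subr_eq0.
have -> : (f w - f a) / (w - a) - l = (f w - f a - l * (w - a)) / (w - a).
  by field.
move=> h; rewrite normcM normcV (@le_lt_trans _ _ (e / 2))//; last by lra.
by rewrite ler_pdivrMr ?normc_gt0.
Qed.

Lemma derivable_near F G z (d : R) : 0 < d ->
  (forall w, normc (w - z) < d -> F w = G w) ->
  derivable F z 1 -> derivable G z 1.
Proof.
move=> d0 FG /derivcP[l H]; apply/derivcP; exists l => e e0.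
have [d' d'0 dH] := H e e0; exists (Num.min d d'); first by rewrite lt_min d0.
move=> w; rewrite lt_min => /andP[wd wd'].
by rewrite -!FG ?subrr ?normc0//; exact: dH.
Qed.

(** The difference quotient has zero integral by [cauchy_diamond]. *)
Lemma cauchy_formula f a : normc (a - w0) <= rho / 4 ->
  (forall z, disc w0 rho z -> derivable f z 1) ->
  oint w0 rho (fun z => f z / (z - a)) = f a * kappa.
Proof.
move=> aw df; have Da : disc w0 rho a by apply: (le_trans aw); have := rho0; lra.
have [l cl] := dquot_cont (df _ Da).
have dq z : disc w0 rho z -> z != a -> derivable (dquot f a l) z 1.
  move=> Dz za; have d0 : 0 < normc (z - a) by rewrite normc_gt0 subr_eq0.
  have dquo := @derivc_quot R f a (f a) z za (df _ Dz).
  apply: (@derivable_near _ (dquot f a l) z _ d0 _ dquo) => w wz.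
  rewrite /dquot; case: eqVneq => // wa.
  by rewrite wa normc_distC ltxx in wz.
have : oint w0 rho (dquot f a l) = 0.
  apply: (cauchy_diamond rho0 aw _ dq) => z Dz.
  have [->|za] := eqVneq z a; first exact: cl.
  by apply: derivable_cont; exact: dq.
have cfa : edge_continuous w0 rho (fun z => f z / (z - a)).
  move=> k t t01; apply: (@continuousM R[i] (cplx R) f); last exact: edge_cont_invB.
  by apply/derivable_cont/df; exact: disc_edge.
have ci := edge_cont_invB aw.
rewrite (eq_oint (G := fun z => f z / (z - a) - f a * (z - a)^-1)); last first.
  move=> k t t01; rewrite /dquot (negbTE (edge_neq rho0 k t aw)).
  by rewrite mulrBl.
have cfb : edge_continuous w0 rho (fun z => f a * (z - a)^-1).
  move=> k t t01; apply: (@continuousM R[i] (cplx R) (fun=> f a)); last exact: ci.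
  exact: (@cst_continuous (cplx R) (cplx R)).
by rewrite (ointB cfa cfb) (ointZ (f a) ci) oint_inv// => /eqP; rewrite subr_eq0 => /eqP.
Qed.

End CauchyFormula.

(** * Slopes as Cauchy integrals *)

Section Kernel.
Variable R : realType.
Implicit Types (F G f h : cplx R -> cplx R) (a b c z w : R[i]) (t e : R).
Implicit Types (s : seq R[i]).

Lemma contc_mul F G z : {for z, continuous F} -> {for z, continuous G} ->
  {for z, continuous (fun w : cplx R => F w * G w : cplx R)}.
Proof. exact: (@continuousM R[i] (cplx R)). Qed.

Lemma contc_cst c z : {for z, continuous (fun _ : cplx R => c : cplx R)}.
Proof. exact: (@cst_continuous (cplx R) (cplx R)). Qed.

Lemma contc_inv F z : F z != 0 -> {for z, continuous F} ->
  {for z, continuous (fun w : cplx R => (F w)^-1 : cplx R)}.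
Proof.
move=> F0 Fc.
exact: (@continuous_comp _ _ _ F (@inversion R) z Fc (inversion_cont F0)).
Qed.

Variables (w0 : R[i]) (rho : R).
Hypothesis rho0 : 0 < rho.
Local Notation edge := (edge w0 rho).
Local Notation oint := (oint w0 rho).
Local Notation edge_continuous := (edge_continuous w0 rho).

Definition poles s z : R[i] := \prod_(a <- s) (z - a)^-1.

(** With one pole this is f, with two poles the slope of f, and in general
    the divided difference of f at the poles.  Divided differences of all orders
    give at once continuity and differentiability of the slope. *)
Definition cauchy_int f s : R[i] := (kappa R)^-1 * oint (fun z => f z * poles s z).

Definition inner a := normc (a - w0) <= rho / 4.

Definition inners s := forall a, a \in s -> inner a.

Lemma inners_cons a s : inners (a :: s) <-> inner a /\ inners s.
Proof.
split=> [H|[ia is_] b].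
  by split=> [|b bs]; apply: H; rewrite inE ?eqxx// bs orbT.
by rewrite inE => /orP[/eqP->//|]; exact: is_.
Qed.

Lemma edge_cont_poles s : inners s -> edge_continuous (poles s).
Proof.
elim: s => [|a s IH].
  move=> _ k t _; rewrite (_ : poles [::] = fun=> 1); first exact: contc_cst.
  by apply/funext => z; rewrite /poles big_nil.
move=> /inners_cons[ia is_] k t t01.
rewrite (_ : poles (a :: s) = fun z => (z - a)^-1 * poles s z); last first.
  by apply/funext => z; rewrite /poles big_cons.
apply: contc_mul; last exact: IH.
exact: (edge_cont_invB rho0 ia).
Qed.

Lemma edge_cont_mul_poles f s : edge_continuous f -> inners s -> edge_continuous (fun z => f z * poles s z).
Proof. by move=> fc /edge_cont_poles kc k t t01; apply: contc_mul; [exact: fc|exact: kc]. Qed.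

Lemma poles_bound s k t : inners s -> normc (poles s (edge k t)) <= (4 / rho) ^+ size s.
Proof.
have r4 : 0 < 4 / rho by rewrite divr_gt0.
elim: s => [|a s IH]; first by rewrite /poles big_nil normc1.
move=> /inners_cons[ia is_]; rewrite /poles big_cons normcM exprS normcV.
apply: ler_pM; rewrite ?invr_ge0 ?normc_ge0//; last exact: IH.
rewrite -[4 / rho]invrK lef_pV2 ?posrE ?invr_gt0//.
  by rewrite invf_div; exact: edge_far.
by rewrite normc_gt0 subr_eq0; exact: edge_neq.
Qed.

Definition inv_kappa_norm : R := normc (kappa R)^-1.

Lemma inv_kappa_norm_gt0 : 0 < inv_kappa_norm.
Proof. by rewrite normc_gt0 invr_eq0 kappa_neq0. Qed.

#[global] Opaque inv_kappa_norm.

Definition cauchy_cst n : R := inv_kappa_norm * (16 * rho * (4 / rho) ^+ n).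

Lemma cauchy_cst_gt0 n : 0 < cauchy_cst n.
Proof. by rewrite !mulr_gt0 ?inv_kappa_norm_gt0 ?exprn_gt0 ?divr_gt0. Qed.

Definition edge_bounded f (M : R) := forall k t, (k < 4)%N -> 0 <= t <= 1 ->
  normc (f (edge k t)) <= M.

Lemma cauchy_int_bound f s M : edge_continuous f -> inners s -> edge_bounded f M ->
  normc (cauchy_int f s) <= cauchy_cst (size s) * M.
Proof.
move=> fc is_ fM.
have -> : cauchy_cst (size s) * M = inv_kappa_norm * (16 * rho * (M * (4 / rho) ^+ size s)).
  by rewrite /cauchy_cst; ring.
rewrite /cauchy_int normcM ler_wpM2l ?(ltW inv_kappa_norm_gt0)//.
apply: (oint_bound rho0 (edge_cont_mul_poles fc is_)).
move=> k t k4 t01; rewrite normcM; apply: ler_pM; rewrite ?normc_ge0//.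
  exact: fM.
exact: poles_bound.
Qed.

Lemma cauchy_intB f h s : edge_continuous f -> edge_continuous h -> inners s ->
  cauchy_int (fun z => f z - h z) s = cauchy_int f s - cauchy_int h s.
Proof.
move=> fc hc is_; rewrite /cauchy_int -mulrBr; congr (_ * _).
rewrite -(ointB (edge_cont_mul_poles fc is_) (edge_cont_mul_poles hc is_)).
by apply: eq_oint => k t _; rewrite mulrBl.
Qed.

Lemma cauchy_intC f a b s : cauchy_int f [:: a, b & s] = cauchy_int f [:: b, a & s].
Proof.
congr (_ * _); apply: eq_oint => k t _; rewrite /poles !big_cons.
by congr (_ * _); rewrite mulrCA.
Qed.

(** Partial fractions: 1/(z-a) - 1/(z-b) = (a-b) / ((z-a)(z-b)). *)
Lemma cauchy_int_slope f a b s : edge_continuous f -> inner a -> inner b -> inners s ->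
  cauchy_int f (a :: s) - cauchy_int f (b :: s) = (a - b) * cauchy_int f [:: a, b & s].
Proof.
move=> fc ia ib is_.
have ia' : inners (a :: s) by apply/inners_cons.
have ib' : inners (b :: s) by apply/inners_cons.
have iab : inners [:: a, b & s] by apply/inners_cons.
rewrite /cauchy_int -mulrBr mulrCA; congr (_ * _).
rewrite -(ointB (edge_cont_mul_poles fc ia') (edge_cont_mul_poles fc ib')).
rewrite -(ointZ (a - b) (edge_cont_mul_poles fc iab)).
apply: eq_oint => k t t01.
have ha := edge_neq rho0 k t ia; have hb := edge_neq rho0 k t ib.
rewrite /poles !big_cons; set P := \prod_(_ <- _) _; set x := edge k t in ha hb *.
rewrite -subr_eq0 in ha; rewrite -subr_eq0 in hb.
by field; rewrite ha hb.
Qed.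

Lemma cauchy_int_lip f a b s M : edge_continuous f -> inner a -> inner b -> inners s ->
  edge_bounded f M ->
  normc (cauchy_int f (a :: s) - cauchy_int f (b :: s)) <= cauchy_cst (size s).+2 * M * normc (a - b).
Proof.
move=> fc ia ib is_ fM; rewrite cauchy_int_slope// normcM mulrC ler_wpM2r ?normc_ge0//.
apply: (@cauchy_int_bound f [:: a, b & s]) => //.
by apply/inners_cons; split => //; apply/inners_cons.
Qed.

(** The derivative is the divided difference with the pole b repeated, by two
    applications of [cauchy_int_slope]. *)
Lemma derivable_cauchy_int f b s : edge_continuous f -> (exists M, edge_bounded f M) ->
  normc (b - w0) < rho / 4 -> inners s ->
  derivable (fun z : cplx R => cauchy_int f (z :: s) : cplx R) b 1.
Proof.
move=> fc [M fM] ib is_; apply/derivcP; exists (cauchy_int f [:: b, b & s]) => e e0.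
have M0 : 0 <= M.
  by apply: le_trans (fM 0%N 0 _ _); rewrite ?normc_ge0 ?lexx ?ler01.
pose C := cauchy_cst (size s).+3 * M + 1.
have C0 : 0 < C by rewrite ltr_wpDl// mulr_ge0// ltW// cauchy_cst_gt0.
exists (Num.min (rho / 4 - normc (b - w0)) (e / C)).
  by rewrite lt_min subr_gt0 ib divr_gt0.
move=> w; rewrite lt_min ltr_pdivlMr// => /andP[wd we].
have iw : inner w.
  by have := normc_dist_tri b w w0; rewrite /inner; lra.
have ib' : inner b by exact: ltW.
rewrite cauchy_int_slope// [(w - b) * _]mulrC -mulrBl normcM ler_wpM2r ?normc_ge0//.
have ibs : inners (b :: s) by apply/inners_cons.
rewrite (le_trans (cauchy_int_lip fc iw ib' ibs fM))//=.
apply: le_trans (ltW we); rewrite mulrC ler_wpM2l ?normc_ge0//.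
by rewrite /C lerDl.
Qed.

Lemma cauchy_int1 f a : (forall z, disc w0 rho z -> derivable f z 1) -> inner a ->
  cauchy_int f [:: a] = f a.
Proof.
move=> df ia; rewrite /cauchy_int.
rewrite (eq_oint (G := fun z => f z / (z - a))); last first.
  by move=> k t _; rewrite /poles big_seq1.
by rewrite (cauchy_formula rho0 ia df) mulrC mulfK ?kappa_neq0.
Qed.

Lemma edge_cont_deriv f : (forall z, disc w0 rho z -> derivable f z 1) -> edge_continuous f.
Proof. by move=> df k t t01; apply/derivable_cont/df; exact: disc_edge. Qed.

Lemma cauchy_slope f a b : (forall z, disc w0 rho z -> derivable f z 1) ->
  inner a -> inner b -> f a - f b = (a - b) * cauchy_int f [:: a; b].
Proof.
by move=> df ia ib; rewrite -cauchy_int_slope ?cauchy_int1//; exact: edge_cont_deriv.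
Qed.

(** Cauchy's formula gives the maximum principle up to a constant that does
    not depend on the square, which is enough for every use below. *)
Lemma weak_max_principle f M : (forall z, disc w0 rho z -> derivable f z 1) ->
  edge_bounded f M -> normc (f w0) <= 64 * inv_kappa_norm * M.
Proof.
move=> df fM; have i0 : inner w0 by exact: center_inner.
rewrite -(cauchy_int1 df i0).
have := @cauchy_int_bound f [:: w0] M (edge_cont_deriv df); rewrite /= /cauchy_cst expr1.
have -> : inv_kappa_norm * (16 * rho * (4 / rho)) = 64 * inv_kappa_norm by field; rewrite gt_eqF.
by apply=> //; apply/inners_cons.
Qed.

Lemma edge_cont_bounded f : edge_continuous f -> exists M, edge_bounded f M.
Proof.
move=> fc; have /choice[N HN] : forall k, exists N, forall t, 0 <= t <= 1 ->
    normc (f (edge k t)) <= N.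
  move=> k; have pc := seg_cont_path (fc k).
  have gc : {within `[0, 1], continuous (fun t => normc (f (edge k t)))}.
    apply: within_cc => t t01; apply: contRP => e e0.
    have [d d0 dH] := (cont_pathP _ _).1 (pc t t01) e e0.
    exists d => // u /dH; apply: le_lt_trans; rewrite ler_norml.
    have := normc_dist_ge (f (edge k t)) (f (edge k u)); rewrite normc_distC.
    have := normc_dist_ge (f (edge k u)) (f (edge k t)).
    by rewrite /= -/(edge k u) -/(edge k t) => h1 h2; apply/andP; split; lra.
  have [c _ Hc] := EVT_max ler01 gc.
  by exists (normc (f (edge k c))) => t t01; apply: Hc; rewrite in_itv.
have N0 k : 0 <= N k.
  by apply: le_trans (HN k 0 _); rewrite ?normc_ge0 ?lexx ?ler01.
exists (\sum_(k < 4) N k) => k t k4 t01.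
rewrite (le_trans (HN k t t01))// (bigD1 (Ordinal k4))//= lerDl sumr_ge0//.
Qed.

Lemma edge_cont_bounded_below f : edge_continuous f ->
  (forall k t, 0 <= t <= 1 -> f (edge k t) != 0) ->
  exists2 m, 0 < m & forall k t, (k < 4)%N -> 0 <= t <= 1 ->
    m <= normc (f (edge k t)).
Proof.
move=> fc f0.
have [|M HM] := @edge_cont_bounded (fun z => (f z)^-1).
  by move=> k t t01; apply: contc_inv; [exact: f0|exact: fc].
have M0 : 0 < M.
  apply: lt_le_trans (HM 0%N 0 _ _); rewrite ?lexx ?ler01//.
  by rewrite normc_gt0 invr_eq0 f0// lexx ler01.
exists M^-1; first by rewrite invr_gt0.
move=> k t k4 t01; have := HM k t k4 t01.
have fn0 : 0 < normc (f (edge k t)) by rewrite normc_gt0 f0.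
by rewrite normcV -{1}[M]invrK lef_pV2 ?posrE ?invr_gt0.
Qed.

End Kernel.

(** * Univalent functions *)

Section Univalent.
Variable R : realType.
Implicit Types (F G f h : cplx R -> cplx R) (a b c z w : R[i]) (t e : R).

Definition disc_injective w0 (rho : R) f :=
  forall x y, disc w0 rho x -> disc w0 rho y -> f x = f y -> x = y.

Lemma disc_center w0 (rho : R) : 0 <= rho -> disc w0 rho w0.
Proof. by rewrite /disc subrr normc0. Qed.

Lemma disc_le w0 (r s : R) z : r <= s -> disc w0 r z -> disc w0 s z.
Proof. by move=> rs /le_trans; apply. Qed.

(** Bisecting the segment from a to b n times replaces the bound by its
    2^{-n}-th part. *)
Lemma quadratic_const w0 (d C : R) f : 0 <= C ->
  (forall a b, disc w0 d a -> disc w0 d b ->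
     normc (f a - f b) <= C * normc (a - b) ^+ 2) ->
  forall a b, disc w0 d a -> disc w0 d b -> f a = f b.
Proof.
move=> C0 H a b Da Db.
have {}H n a' b' : disc w0 d a' -> disc w0 d b' ->
    normc (f a' - f b') <= C * normc (a' - b') ^+ 2 * 2^-1 ^+ n.
  elim: n a' b' => [|n IH] x y Dx Dy; first by rewrite expr0 mulr1; exact: H.
  have Dm : disc w0 d (mid x y) by exact: (is_convex_mid (@disc_convex _ w0 d) Dx Dy).
  have := IH _ _ Dx Dm; have := IH _ _ Dm Dy.
  rewrite mid_distr (normc_distC x (mid x y)) mid_dist (normc_distC y x) => h1 h2.
  have h3 := normc_dist_tri (f (mid x y)) (f x) (f y).
  rewrite [2^-1 ^+ n.+1]exprS; set P := 2^-1 ^+ n in h1 h2 *; set N := normc (x - y) in h1 h2 *.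
  have -> : C * N ^+ 2 * (2^-1 * P) =
     C * (2^-1 * N) ^+ 2 * P + C * (2^-1 * N) ^+ 2 * P by field.
  lra.
apply/eqP; rewrite -subr_eq0 -normc_eq0 eq_le normc_ge0 andbT.
apply/ler_addgt0Pr => e e0; rewrite add0r.
have [n Hn] := small_pow (C * normc (a - b) ^+ 2) e0.
exact: le_trans (H n a b Da Db) (ltW Hn).
Qed.

Lemma exists_min2 (x y : R) : 0 < x -> 0 < y ->
  exists m : R, [/\ 0 < m, m <= x & m <= y].
Proof.
by move=> x0 y0; exists (Num.min x y); rewrite lt_min x0 y0 !ge_min !lexx orbT.
Qed.

Variables (w0 : R[i]) (rho : R).
Hypothesis rho0 : 0 < rho.
Variable f : cplx R -> cplx R.
Hypothesis df : forall z, disc w0 rho z -> derivable f z 1.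
Hypothesis fI : disc_injective w0 rho f.
Local Notation cauchy_int := (cauchy_int w0 rho).
Local Notation inner := (inner w0 rho).
Local Notation inv_kappa_norm := (inv_kappa_norm R).

Lemma inners1 a : inner a -> inners w0 rho [:: a].
Proof. by move=> ia b; rewrite inE => /eqP->. Qed.

Lemma inner_disc a : inner a -> disc w0 rho a.
Proof. by apply: disc_le; have := rho0; lra. Qed.

(** Suppose f' w0 = 0, and let u_a z = (f z - f a) / (z - a).  By injectivity
    u_{w0} vanishes only at w0, so |u_{w0}| >= m > 0 on the boundary of a small
    square.  For a near w0, |u_a| >= m/2 there while |u_a w0| is small, which
    contradicts the maximum principle for 1 / u_a unless u_a has a zero.  By
    injectivity this zero is a, that is f' a = 0.  So f' = 0 near w0, whence
    |f a - f b| <= C |a - b|^2 there, and f is constant near w0. *)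
Lemma univalent_slope_neq0 : cauchy_int f [:: w0; w0] != 0.
Proof.
apply/eqP => k0.
have fc := edge_cont_deriv rho0 df.
have [M fM] := edge_cont_bounded fc.
have M0 : 0 <= M.
  by apply: le_trans (fM 0%N 0 _ _); rewrite ?normc_ge0 ?lexx ?ler01.
have i0 : inner w0 by exact: center_inner.
pose r := rho / 8; have r0 : 0 < r by rewrite divr_gt0.
have dr z : disc w0 r z -> normc (z - w0) < rho / 4.
  by rewrite /disc /r => h; have := rho0; lra.
have dri z : disc w0 r z -> inner z by move=> /dr /ltW.
have kne a z : inner a -> inner z -> a != z -> cauchy_int f [:: z; a] != 0.
  move=> ia iz /eqP az; apply/eqP => kz; apply: az.
  apply: fI; [exact: inner_disc|exact: inner_disc|apply/esym/eqP].
  by rewrite -subr_eq0 (cauchy_slope rho0 df)// kz mulr0.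
(* u a is the difference quotient of f at a *)
pose u a : cplx R -> cplx R := fun z => cauchy_int f [:: z; a].
have du a z : inner a -> disc w0 r z -> derivable (u a) z 1.
  move=> ia Dz; apply: derivable_cauchy_int => //; [by exists M|exact: dr|exact: inners1].
have [C [C0 CM]] : exists C, 0 < C /\ cauchy_cst rho 3 * M <= C.
  exists (cauchy_cst rho 3 * M + 1); rewrite lerDl ler01; split => //.
  by rewrite ltr_wpDl// mulr_ge0// ltW// cauchy_cst_gt0.
have lip a b z : inner a -> inner b -> inner z ->
    normc (cauchy_int f [:: a; z] - cauchy_int f [:: b; z]) <= C * normc (a - b).
  move=> ia ib iz; rewrite (le_trans (cauchy_int_lip rho0 fc ia ib (inners1 iz) fM))//=.
  by rewrite ler_wpM2r ?normc_ge0.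
have [m m0 Hm] : exists2 m, 0 < m & forall k t, (k < 4)%N -> 0 <= t <= 1 ->
    m <= normc (u w0 (edge w0 r k t)).
  apply: (@edge_cont_bounded_below _ w0 r).
    by move=> k t t01; apply: derivable_cont; apply: du => //; exact: disc_edge.
  move=> k t t01; apply: kne => //; first by apply: dri; exact: disc_edge.
  by rewrite eq_sym; apply: edge_neq => //; exact: center_inner.
have ck0 : 0 < inv_kappa_norm by exact: inv_kappa_norm_gt0.
have ck1 := mulr_gt0 (ltr0Sn R 255) ck0.
have Cck0 := mulr_gt0 ck1 C0.
have [d1 [d10 d1m d1c]] := exists_min2 (divr_gt0 m0 (mulr_gt0 (ltr0Sn R 1) C0))
  (divr_gt0 m0 Cck0).
have [d [d0 dr1 dd1]] := exists_min2 r0 d10.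
have crit a : disc w0 d a -> cauchy_int f [:: a; a] = 0.
  move=> Da; have ar : normc (a - w0) <= r by exact: le_trans Da dr1.
  have am : C * normc (a - w0) <= m / 2.
    have : normc (a - w0) <= m / (2 * C) by rewrite (le_trans Da)// (le_trans dd1).
    by rewrite ler_pdivlMr ?mulr_gt0// => h; lra.
  have ac : C * normc (a - w0) <= m / (256 * inv_kappa_norm).
    have : normc (a - w0) <= m / (256 * inv_kappa_norm * C).
      by rewrite (le_trans Da)// (le_trans dd1).
    by rewrite invfM mulrA ler_pdivlMr// mulrC.
  have ia : inner a by exact: dri.
  have [] := pselect (exists2 z, disc w0 r z & u a z = 0).
    move=> [z Dz uz]; have [za|za] := eqVneq z a; first by rewrite -{1}za; exact: uz.
    by have := kne a z ia (dri _ Dz); rewrite eq_sym => /(_ za); rewrite -/(u a z) uz eqxx.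
  move=> nz; have unz z : disc w0 r z -> u a z != 0.
    by move=> Dz; apply/eqP => uz; apply: nz; exists z.
  have dv z : disc w0 r z -> derivable (fun z : cplx R => (u a z)^-1 : cplx R) z 1.
    by move=> Dz; apply: derivc_inv; [exact: unz|exact: du].
  have vb : edge_bounded w0 r (fun z => (u a z)^-1) (2 / m).
    move=> k t k4 t01; have De := disc_edge w0 r0 k t01.
    rewrite normcV -[leRHS]invrK lef_pV2 ?posrE ?invr_gt0 ?divr_gt0//; last first.
      by rewrite normc_gt0 unz.
    rewrite invf_div; have h1 := Hm k t k4 t01.
    have h2 := lip w0 a _ i0 ia (dri _ De).
    have h3 := normc_dist_ge (u w0 (edge w0 r k t)) (u a (edge w0 r k t)).
    rewrite cauchy_intC [cauchy_int f [:: a; _]]cauchy_intC -/(u w0 _) -/(u a _) normc_distC in h2.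
    rewrite (normc_distC w0) in h2.
    rewrite normc_distC in h3.
    lra.
  have := @weak_max_principle R w0 r r0 _ _ dv vb; rewrite normcV.
  have := lip a w0 w0 ia i0 i0; rewrite k0 subr0 cauchy_intC -/(u a w0) => h1.
  have un0 : 0 < normc (u a w0) by rewrite normc_gt0; apply: unz; apply: disc_center; exact: ltW.
  have h2 : normc (u a w0) <= m / (256 * inv_kappa_norm) by exact: le_trans h1 ac.
  rewrite leNgt => /negP[].
  rewrite -[ltLHS]invrK ltf_pV2 ?posrE ?invr_gt0 ?mulr_gt0 ?invr_gt0 ?mulr_gt0//.
  apply: (le_lt_trans h2).
  have -> : 64 * inv_kappa_norm * (2 / m) = (m / (128 * inv_kappa_norm))^-1.
    by field; rewrite !gt_eqF.
  rewrite invrK ltr_pM2l// ltf_pV2 ?posrE ?mulr_gt0 ?ltr0n//.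
  by rewrite ltr_pM2r// ltr_nat.
have ddi a : disc w0 d a -> inner a.
  by move=> Da; apply: dri; exact: disc_le Da.
have fconst : forall a b, disc w0 d a -> disc w0 d b -> f a = f b.
  apply: (quadratic_const (ltW C0)) => a b Da Db.
  rewrite (cauchy_slope rho0 df) ?ddi//.
  have := lip a b b (ddi _ Da) (ddi _ Db) (ddi _ Db).
  rewrite (crit b Db) subr0 => h; rewrite normcM.
  by rewrite expr2 mulrA [leLHS]mulrC ler_wpM2r ?normc_ge0.
have Dd : disc w0 d (w0 + d%:C).
  by rewrite /disc addrAC subrr add0r normc_real gtr0_norm.
have /eqP : w0 = w0 + d%:C.
  apply: fI; [exact: disc_center (ltW rho0)|exact: inner_disc (ddi _ Dd)|].
  by apply: fconst => //; apply: disc_center; exact: ltW.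
rewrite -{1}[w0]addr0 => /eqP/addrI/esym/eqP.
by rewrite -normc_eq0 normc_real gtr0_norm// gt_eqF.
Qed.

(** The slope of h is close to that of f, and the latter stays near its
    nonzero value at (w0, w0); this gives the lower bound with c a third of that
    value, the two other thirds absorbing both errors.  If h omitted a value xi
    very close to h w0, then 1 / (h - xi) would be holomorphic, bounded on a
    square by the lower bound, and too large at the centre for the maximum
    principle. *)
Lemma stable_local_inverse : exists c s eps eta : R,
  [/\ 0 < c, 0 < s, s <= rho, 0 < eps & 0 < eta] /\
  forall h, (forall z, disc w0 rho z -> derivable h z 1) ->
    (forall z, disc w0 rho z -> normc (h z - f z) <= eps) ->
    (forall a b, disc w0 s a -> disc w0 s b ->
       c * normc (a - b) <= normc (h a - h b)) /\
    (forall xi, normc (xi - h w0) < eta -> exists2 b, disc w0 s b & h b = xi).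
Proof.
have fc := edge_cont_deriv rho0 df.
have [M fM] := edge_cont_bounded fc.
have M0 : 0 <= M.
  by apply: le_trans (fM 0%N 0 _ _); rewrite ?normc_ge0 ?lexx ?ler01.
have i0 : inner w0 by exact: center_inner.
have [C [C0 CM]] : exists C, 0 < C /\ cauchy_cst rho 3 * M <= C.
  exists (cauchy_cst rho 3 * M + 1); rewrite lerDl ler01; split => //.
  by rewrite ltr_wpDl// mulr_ge0// ltW// cauchy_cst_gt0.
have lip a b z : inner a -> inner b -> inner z ->
    normc (cauchy_int f [:: a; z] - cauchy_int f [:: b; z]) <= C * normc (a - b).
  move=> ia ib iz; rewrite (le_trans (cauchy_int_lip rho0 fc ia ib (inners1 iz) fM))//=.
  by rewrite ler_wpM2r ?normc_ge0.
pose N := normc (cauchy_int f [:: w0; w0]).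
have N0 : 0 < N by rewrite normc_gt0 univalent_slope_neq0.
have [c [c0 cN]] : exists c : R, 0 < c /\ N = 3 * c.
  by exists (N / 3); split; [rewrite divr_gt0|field].
have rho4 : 0 < rho / 4 by rewrite divr_gt0.
have [s [s0 sr4 sC2]] := exists_min2 rho4 (divr_gt0 c0 (mulr_gt0 (ltr0Sn R 1) C0)).
have sr : s <= rho by lra.
have si a : disc w0 s a -> inner a by move=> Da; exact: le_trans Da sr4.
have sC a : disc w0 s a -> C * normc (a - w0) <= c / 2.
  move=> Da; have := le_trans Da sC2; rewrite ler_pdivlMr ?mulr_gt0// => h; lra.
have kc0 : 0 < cauchy_cst rho 2 by exact: cauchy_cst_gt0.
have [eps [eps0 epsc]] : exists eps, 0 < eps /\ cauchy_cst rho 2 * eps <= c.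
  exists (c / cauchy_cst rho 2); split; first by rewrite divr_gt0.
  by rewrite mulrC divfK// gt_eqF.
have ck0 : 0 < inv_kappa_norm by exact: inv_kappa_norm_gt0.
have cs0 : 0 < c * s by exact: mulr_gt0.
have ck1 := mulr_gt0 (ltr0Sn R 1023) ck0.
have [eta [eta0 eta1 eta2]] := exists_min2 (divr_gt0 cs0 (ltr0Sn R 7)) (divr_gt0 cs0 ck1).
exists c, s, eps, eta; split; first by [].
move=> h dh hf; have hc := edge_cont_deriv rho0 dh.
have low a b : disc w0 s a -> disc w0 s b ->
    c * normc (a - b) <= normc (h a - h b).
  move=> Da Db; have ia := si _ Da; have ib := si _ Db.
  rewrite (cauchy_slope rho0 dh)// normcM mulrC ler_wpM2l ?normc_ge0//.
  have iab : inners w0 rho [:: a; b].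
    by apply/inners_cons; split => //; exact: inners1.
  have h1 : normc (cauchy_int h [:: a; b] - cauchy_int f [:: a; b]) <= c.
    have hb : edge_bounded w0 rho (fun z => h z - f z) eps.
      by move=> k t k4 t01; apply: hf; exact: disc_edge.
    have hfc : edge_continuous w0 rho (fun z => h z - f z).
      by move=> k t t01; apply: (@continuousB R[i] (cplx R) (cplx R)); [exact: hc|exact: fc].
    have := cauchy_int_bound rho0 hfc iab hb.
    by rewrite (cauchy_intB rho0 hc fc iab) => h0; exact: le_trans h0 epsc.
  have h2 := le_trans (lip _ _ _ ia i0 ib) (sC _ Da).
  have h3 := le_trans (lip _ _ _ ib i0 i0) (sC _ Db).
  rewrite cauchy_intC in h3.
  have h4 := normc_dist_tri (cauchy_int f [:: w0; b]) (cauchy_int f [:: a; b]) (cauchy_int f [:: w0; w0]).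
  have h5 := normc_dist_tri (cauchy_int f [:: a; b]) (cauchy_int h [:: a; b]) (cauchy_int f [:: w0; w0]).
  have h6 := normc_dist_ge (cauchy_int f [:: w0; w0]) (cauchy_int h [:: a; b]).
  have h7 := normc_distC (cauchy_int f [:: w0; w0]) (cauchy_int h [:: a; b]).
  rewrite -/N cN in h6; move: h1 h2 h3 h4 h5 h6 h7; rewrite -/N; clear -c0.
  move: (cauchy_int h _) (cauchy_int f [:: a; b]) (cauchy_int f [:: w0; b]).
  move: (cauchy_int f _) => x1 x2 x3 x4 *; lra.
split => // xi xih; apply: contrapT => nob.
have hx z : disc w0 s z -> h z - xi != 0.
  by move=> Dz; rewrite subr_eq0; apply/eqP => E; apply: nob; exists z.
have D0 : disc w0 s w0 by apply: disc_center; exact: ltW.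
have dv z : disc w0 s z -> derivable (fun z : cplx R => (h z - xi)^-1 : cplx R) z 1.
  move=> Dz; apply: (@derivc_inv _ (fun z => h z - xi)); first exact: hx.
  by apply: derivc_sub; apply: dh; exact: disc_le Dz.
have xi1 := lt_le_trans xih eta1; have xi2 := lt_le_trans xih eta2.
have vb : edge_bounded w0 s (fun z => (h z - xi)^-1) (8 / (c * s)).
  move=> k t k4 t01; have De := disc_edge w0 s0 k t01.
  rewrite normcV -[leRHS]invrK lef_pV2 ?posrE ?invr_gt0 ?divr_gt0//; last first.
    by rewrite normc_gt0 hx.
  rewrite invf_div.
  have h1 := low _ _ De D0.
  have h2 := edge_far k t (center_inner w0 s0).
  have h3 : c * (s / 4) <= c * normc (edge w0 s k t - w0) by rewrite ler_pM2l.
  have h4 := normc_dist_tri xi (h (edge w0 s k t)) (h w0).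
  lra.
have := @weak_max_principle R w0 s s0 _ _ dv vb; rewrite normcV leNgt => /negP[].
have x0 : 0 < normc (h w0 - xi) by rewrite normc_gt0 hx.
rewrite -[ltLHS]invrK ltf_pV2 ?posrE ?invr_gt0 ?mulr_gt0 ?invr_gt0 ?mulr_gt0//.
rewrite normc_distC (lt_le_trans xi2)//.
have -> : (64 * inv_kappa_norm * (8 / (c * s)))^-1 = c * s / (512 * inv_kappa_norm).
  by field; rewrite !gt_eqF.
rewrite ler_pM2l// lef_pV2 ?posrE ?mulr_gt0 ?ltr0n//.
by rewrite ler_pM2r// ler_nat.
Qed.

End Univalent.

(** * Differentiability of a local inverse *)

Section Preimage.
Variable R : realType.

(** The lower bound at phi z makes phi Lipschitz at z and the derivative of f
    at phi z nonzero; then the chain rule can be solved for the derivative of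
    phi. *)
Lemma derivable_preimage (F f phi : cplx R -> cplx R) (z : cplx R) (s c : R) :
  0 < s -> 0 < c -> derivable F z 1 -> derivable f (phi z) 1 ->
  (forall a, disc (phi z) s a ->
     c * normc (a - phi z) <= normc (f a - f (phi z))) ->
  (exists2 d : R, 0 < d & forall w, normc (w - z) < d ->
     disc (phi z) s (phi w) /\ f (phi w) = F w) ->
  derivable phi z 1.
Proof.
move=> s0 c0 /derivcP[l Hl] /derivcP[L HL] low [d d0 Hd].
set w0 := phi z in HL low Hd *.
have fw0 : f w0 = F z by case: (Hd z) => //; rewrite subrr normc0.
have L0 : 0 < normc L.
  have [|e e0 He] := HL (c / 2); first by rewrite divr_gt0.
  have [x [x0 xs xe]] := exists_min2 s0 (divr_gt0 e0 (ltr0Sn R 1)).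
  have xE : normc (w0 + x%:C - w0) = x.
    by rewrite addrAC subrr add0r normc_real gtr0_norm.
  have h1 := low (w0 + x%:C); rewrite /disc xE in h1; have {}h1 := h1 xs.
  have h2 := He (w0 + x%:C); rewrite xE in h2.
  have {}h2 := h2 ltac:(lra).
  have h3 := normc_dist_ge (f (w0 + x%:C) - f w0) (L * (w0 + x%:C - w0)).
  rewrite normcM xE in h3.
  have h4 : 0 < c * x by exact: mulr_gt0.
  have h5 : 0 < normc L * x by lra.
  by rewrite pmulr_lgt0 in h5.
have [e1 He1 H1] := Hl 1 ltr01.
pose K := (normc l + 1) / c.
have K0 : 0 < K by rewrite divr_gt0// ltr_wpDl ?normc_ge0.
have lipphi w : normc (w - z) < d -> normc (w - z) < e1 ->
    normc (phi w - w0) <= K * normc (w - z).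
  move=> wd we; have [Dw Ew] := Hd w wd.
  have h1 := low _ Dw; rewrite Ew fw0 in h1.
  have h2 := H1 w we; rewrite mul1r in h2.
  have h3 := normc_dist_ge (F w - F z) (l * (w - z)); rewrite normcM in h3.
  rewrite /K mulrAC ler_pdivlMr// mulrC; lra.
apply/derivcP; exists (l / L) => e e0.
have a0 : 0 < e * normc L / 2 by rewrite divr_gt0// mulr_gt0.
have [e2 e20 H2] := Hl _ a0.
have b0 : 0 < e * normc L / 2 / K by rewrite divr_gt0.
have [e3 e30 H3] := HL _ b0.
have [m1 [m10 m1d m1e]] := exists_min2 d0 He1.
have [m2 [m20 m2a m2b]] := exists_min2 e20 (divr_gt0 e30 K0).
have [m [m0 mm1 mm2]] := exists_min2 m10 m20.
exists m => // w wm.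
have wd : normc (w - z) < d by apply: lt_le_trans wm _; lra.
have we1 : normc (w - z) < e1 by apply: lt_le_trans wm _; lra.
have we2 : normc (w - z) < e2 by apply: lt_le_trans wm _; lra.
have we3 : K * normc (w - z) < e3.
  by rewrite mulrC -ltr_pdivlMr//; apply: lt_le_trans wm _; lra.
have lw := lipphi w wd we1.
have h2 := H2 w we2.
have h3 := H3 (phi w) (le_lt_trans lw we3).
have [_ Ew] := Hd w wd; rewrite Ew fw0 in h3.
have L0' : L != 0 by rewrite -normc_gt0.
rewrite -(ler_pM2l L0) -normcM.
have -> : L * (phi w - w0 - l / L * (w - z)) =
  (F w - F z - l * (w - z)) - (F w - F z - L * (phi w - w0)) by field.
apply: (le_trans (normcD _ _)); rewrite normc_opp.
have h4 : e * normc L / 2 / K * normc (phi w - w0) <= e * normc L / 2 * normc (w - z).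
  rewrite -mulrA ler_pM2l// mulrC ler_pdivrMr// mulrC//.
lra.
Qed.

End Preimage.

(** * Gluing local estimates on an interval *)

Section Cousin.
Variable R : realType.

(** The supremum of the x such that P S x holds is attained and cannot be
    less than T. *)
Lemma cousin (P : R -> R -> Prop) (S T : R) : S <= T ->
  (forall a b c, S <= a -> a <= b -> b <= c -> c <= T -> P a b -> P b c -> P a c) ->
  (forall x, S <= x <= T -> exists2 d, 0 < d & forall a b,
     S <= a -> a <= x -> x <= b -> b <= T -> x - d < a -> b < x + d -> P a b) ->
  P S T.
Proof.
move=> ST add loc.
have refl x : S <= x <= T -> P x x.
  move=> /[dup] xST /loc[d d0]; apply => //; try lra; by case/andP: xST.
pose E := [set x : R | S <= x <= T /\ P S x].
have ES : E S by split; [rewrite lexx|apply: refl; rewrite lexx].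
have hsE : has_sup E by split; [exists S|exists T => x [/andP[]]].
pose m := sup E.
have Sm : S <= m by apply: ub_le_sup => //; case: hsE.
have mT : m <= T by apply: ge_sup; [case: hsE|move=> x [/andP[]]].
have mST : S <= m <= T by rewrite Sm mT.
have [d d0 Hd] := loc m mST.
have [x [/andP[Sx xT] PSx] xm] := sup_adherent d0 hsE.
have xlem : x <= m by apply: ub_le_sup; [case: hsE|split; rewrite ?Sx].
pose y := Num.min T (m + d / 2).
have my : m <= y by rewrite le_min mT lerDl divr_ge0// ltW.
have yT : y <= T by rewrite ge_min lexx.
have yd : y < m + d by rewrite gt_min ltrD2l ltr_pdivrMr// mulr_natr mulr2n ltrDl d0 orbT.
have Pxy : P x y by apply: Hd.
have PSy : P S y by apply: add Pxy => //; exact: le_trans my.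
have ym : y <= m by apply: ub_le_sup; [case: hsE|split => //; rewrite yT (le_trans Sm)].
have [Ty|yT'] := eqVneq y T; first by rewrite -Ty.
have : y = m + d / 2.
  by move: yT'; rewrite /y minEle; case: ifP => //; rewrite eqxx.
by move=> yE; move: ym; rewrite yE; lra.
Qed.

End Cousin.

(** * Time integrals of L^d densities *)

Section Admissible.
Variable R : realType.
Variable d : \bar R.
Hypothesis hd : (1 <= d)%E.
Implicit Types (k : R -> R) (S T : R).
Local Notation mu := (@lebesgue_measure R).

(** On a bounded interval |k| <= 1 + |k|^p, or |k| is essentially bounded. *)
Lemma Ld_integrable S T k : Ld_on d S T k -> mu.-integrable `[S, T] (EFin \o k).
Proof.
rewrite /Ld_on => kL.
have muST : (mu `[S, T]%classic < +oo)%E.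
  by rewrite lebesgue_measure_itv /=; case: ifPn => _; rewrite ?ltry// -EFinB ltry.
have ind : mu.-integrable `[S, T] (EFin \o cst (1 : R)).
  by apply: integrable_cc => t _; exact: cvg_cst.
suff : mu.-integrable `[S, T] (EFin \o (k \_ `[S, T])).
  by apply: eq_integrable => // x xST /=; rewrite patchE xST.
move: kL; set g := k \_ _; move=> /[dup] kL.
rewrite inE => /andP[/[!inE]/= mg _].
case: d hd kL => [p p1 kL|_ kL|//].
- have ip : mu.-integrable `[S, T] (fun x => (`|g x| `^ p)%:E).
    by apply: integrableS (Lfun_integrable p1 kL) => //; exact: measurable_itv.
  have iG : mu.-integrable `[S, T] ((EFin \o cst (1 : R)%R) \+ (fun x => (`|g x| `^ p)%:E))%E.
    by apply: integrableD => //; exact: measurable_itv.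
  apply: le_integrable iG => //.
  + exact/measurable_realfun.measurable_EFinP/measurable_funTS.
  + move=> x _; rewrite [leRHS]/= lee_fin [leRHS]ger0_norm ?addr_ge0 ?powR_ge0//.
    have [g1|g1] := leP `|g x| 1; first by rewrite (le_trans g1)// lerDl powR_ge0.
    by rewrite (le_trans (le1r_powR (ltW g1) p1))// lerDr.
- move: kL; rewrite inE => /andP[_ /[!inE]/=].
  rewrite /finite_norm unlock /Lnorm.
  case: ifPn => [mu0 ltoo|]; last first.
    move=> /negP[]; have h01 : (0 < mu `[0%R, 1%R]%classic)%E.
      by rewrite lebesgue_measure_itv /= lte_fin ltr01 -EFinB lte_fin subr0.
    by apply: (lt_le_trans h01); apply: le_measure; rewrite ?inE.
  have [M HM] := ess_sup_inf.ess_supr_bounded ltoo.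
  apply/integrableP; split; first exact/measurable_realfun.measurable_EFinP/measurable_funTS.
  apply: (@le_lt_trans _ _ (\int[mu]_(x in `[S, T]) (cst `|M|%R%:E x))%E).
    apply: ae_ge0_le_integral => //.
    + by apply/measurable_realfun.measurable_EFinP/measurableT_comp => //; exact: measurable_funTS.
    + by move=> x _; rewrite lee_fin.
    + by move: HM; apply: filterS => x /= Hx _; rewrite lee_fin (le_trans Hx)// ler_norm.
  have cM t : S <= t <= T -> {for t, continuous (cst `|M|)}.
    by move=> _; exact: cvg_cst.
  have /integrableP[_] := integrable_cc cM.
  by apply: le_lt_trans; rewrite le_eqVlt; apply/orP; left; apply/eqP;
    apply: eq_integral => x _ /=; rewrite normr_id.
Qed.

(** Nonnegativity is required everywhere, so that densities given on
    subintervals can be extended by zero and added. *)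
Definition admissible S T k := (forall x, 0 <= k x) /\ Ld_on d S T k.

Lemma admissible_restrict S T S' T' k : S <= S' -> T' <= T ->
  (forall x, x \in `[S', T'] -> 0 <= k x) -> Ld_on d S' T' k ->
  admissible S T (k \_ `[S', T']).
Proof.
move=> SS TT k0 kL; split.
  move=> x; rewrite patchE; case: ifPn => //; rewrite inE; exact: k0.
rewrite /Ld_on (_ : (k \_ _) \_ _ = k \_ `[S', T'])//.
apply/funext => x; rewrite !patchE; case: ifPn => //; case: ifPn => //.
rewrite !inE /= !in_itv /= => /andP[h1 h2] /negP[].
by rewrite inE /= in_itv /= (le_trans SS)// (le_trans h2).
Qed.

Lemma admissibleD S T k1 k2 : admissible S T k1 -> admissible S T k2 ->
  admissible S T (fun x => k1 x + k2 x).
Proof.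
move=> [k10 L1] [k20 L2]; split; first by move=> x; rewrite addr_ge0.
rewrite /Ld_on (_ : (fun x => k1 x + k2 x) \_ _ = k1 \_ `[S, T] + k2 \_ `[S, T]).
  by have [_] := Lfun_addr_closed mu hd; apply.
by apply/funext => x; rewrite fctE !patchE; case: ifPn => //; rewrite addr0.
Qed.

Lemma admissibleZ S T k (c : R) : 0 <= c -> admissible S T k -> admissible S T (fun x => c * k x).
Proof.
move=> c0 [k0 kL]; split; first by move=> x; rewrite mulr_ge0.
rewrite /Ld_on (_ : (fun x => c * k x) \_ _ = c *: (k \_ `[S, T])).
  have [h0 hs] := Lfun_submod_closed mu hd.
  by rewrite -[_ *: _]addr0; apply: hs.
by apply/funext => x; rewrite fctE !patchE; case: ifPn => //; rewrite scaler0.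
Qed.

Lemma admissible0 S T : admissible S T (fun=> 0).
Proof.
split=> // ; rewrite /Ld_on (_ : _ \_ _ = 0); last first.
  by apply/funext => x; rewrite patchE; case: ifP.
by have [] := Lfun_addr_closed mu hd.
Qed.

Definition time_int k u t : R := \int[mu]_(x in `[u, t]) k x.

Lemma admissible_integrable S T k u t : admissible S T k -> S <= u -> t <= T ->
  mu.-integrable `[u, t] (EFin \o k).
Proof.
move=> [_ /Ld_integrable H] Su tT; apply: integrableS H => //.
by move=> x /=; rewrite !in_itv /= => /andP[h1 h2]; rewrite (le_trans Su)// (le_trans h2).
Qed.

Lemma time_int_split k u b t : mu.-integrable `[u, t] (EFin \o k) -> u <= b -> b <= t ->
  time_int k u t = time_int k u b + time_int k b t.
Proof.
move=> ki ub bt; have := @Rintegral_itvB R k (BLeft u) (BRight t) b ki.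
rewrite !bnd_simp => /(_ ub bt) /eqP; rewrite subr_eq addrC => /eqP; rewrite /time_int => ->.
congr (_ + _); apply: Rintegral_itv_obnd_cbnd.
apply: integrableS ki => // x /=; rewrite !in_itv /= => /andP[h1 ->].
by rewrite (ltW (le_lt_trans ub h1)).
Qed.

Lemma le_time_int S T k1 k2 u t : admissible S T k1 -> admissible S T k2 -> S <= u -> t <= T ->
  (forall x, k1 x <= k2 x) -> time_int k1 u t <= time_int k2 u t.
Proof.
move=> a1 a2 Su tT k12; apply: le_Rintegral => //.
- exact: admissible_integrable a1 _ _.
- exact: admissible_integrable a2 _ _.
Qed.

Lemma time_intZ S T k (c : R) u t : admissible S T k -> S <= u -> t <= T ->
  time_int (fun x => c * k x) u t = c * time_int k u t.
Proof. by move=> a Su tT; apply: RintegralZl => //; exact: admissible_integrable a _ _. Qed.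

(** Absolute continuity of the integral, in the form of a local smallness
    statement. *)
Lemma time_int_small S T k (x e : R) : S <= T ->
  mu.-integrable `[S, T] (EFin \o k) -> S <= x <= T -> 0 < e ->
  exists2 dl, 0 < dl & forall u t, S <= u -> u <= t -> t <= T ->
    `|u - x| < dl -> `|t - x| < dl -> time_int k u t < e.
Proof.
move=> ST ki /andP[Sx xT] e0.
have kc := parameterized_integral_continuous ST ki.
have {kc} /= kc : forall e', 0 < e' -> exists2 dl, 0 < dl & forall u,
    S <= u -> u <= T -> `|u - x| < dl -> `|time_int k S u - time_int k S x| < e'.
  move=> e' e'0.
  have xST : `[S, T]%classic x by rewrite /= in_itv /= Sx xT.
  have /subspace_continuousP/(_ x xST) := kc.
  move=> /cvgrPdist_lt /(_ e' e'0).
  rewrite near_withinE => /nbhs_ballP[dl /= dl0 H]; exists dl => // u Su uT ux.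
  by have := H u; rewrite /ball /= distrC => /(_ ux); rewrite in_itv /= Su uT distrC; apply.
have [|dl dl0 H] := kc (e / 2); first by rewrite divr_gt0.
exists dl => // u t Su ut tT ux tx.
have h1 := H u Su (le_trans ut tT) ux; have h2 := H t (le_trans Su ut) tT tx.
have h3 : time_int k S t = time_int k S u + time_int k u t.
  apply: time_int_split => //; apply: integrableS ki => //.
  by move=> y /=; rewrite !in_itv /= => /andP[-> h]; exact: le_trans tT.
move: h1 h2; rewrite !ltr_norml => /andP[? ?] /andP[? ?]; lra.
Qed.

End Admissible.

(** * Discs and squares in the plane *)

Section Plane.
Variable R : realType.
Implicit Types (z w a : cplx R).

Lemma open_disc (A : set (cplx R)) z : open A -> A z ->
  exists2 rho : R, 0 < rho & forall w, disc z rho w -> A w.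
Proof.
move=> oA Az; have /nbhs_ballP[e /= e0 He] : nbhs z A by exact: open_nbhs_nbhs.
have eE : e = (Re e)%:C by rewrite RRe_real// gtr0_real.
have e0' : 0 < Re e by rewrite -ltcR -eE.
exists (Re e / 2); first by rewrite divr_gt0.
move=> w; rewrite /disc => wz; apply: He; rewrite /ball /= distrC norm_normc eE ltcR.
by rewrite (le_lt_trans wz)// ltr_pdivrMr// mulr_natr mulr2n ltrDl.
Qed.

Definition square z (rho : R) : set (cplx R) :=
  [set w | `|Re w - Re z| <= rho /\ `|Im w - Im z| <= rho].

Lemma compact_square z rho : compact (square z rho).
Proof.
pose g (x : R * R) : cplx R := Complex x.1 x.2.
pose I (x : R) := `[x - rho, x + rho]%classic.
have -> : square z rho = g @` (I (Re z) `*` I (Im z)).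
  apply/seteqP; split => [w [h1 h2]|w [[x y] [/= h1 h2] <-]].
    exists (Re w, Im w); last by case: (w).
    by split; rewrite /I /= in_itv /= -ler_distl.
  by split; rewrite /= ler_distl; [move: h1|move: h2]; rewrite /I /= in_itv.
apply: continuous_compact; last first.
  by apply: compact_setX; exact: segment_compact.
apply: continuous_subspaceT => x.
apply/(@cvgrPdist_lt R[i] (cplx R) _ _ (nbhs_filter x)) => e e0.
have eE : e = (Re e)%:C by rewrite RRe_real// gtr0_real.
have e0' : 0 < Re e / 2 by rewrite divr_gt0// -ltcR -eE.
apply/nbhs_ballP; exists (Re e / 2) => //= y [/= h1 h2].
rewrite norm_normc eE ltcR (le_lt_trans (normc_le_ReIm _))// /g ReB ImB /=.
by rewrite /ball /= in h1 h2; lra.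
Qed.

Lemma disc_square z rho w : disc z rho w -> square z rho w.
Proof.
rewrite /disc /square /= -ReB -ImB => h.
by split; [exact: le_trans (abs_Re _) h|exact: le_trans (abs_Im _) h].
Qed.

Lemma square_disc z rho w : square z rho w -> disc z (2 * rho) w.
Proof.
rewrite /disc /square /= -ReB -ImB => -[h1 h2].
by rewrite (le_trans (normc_le_ReIm _))//; lra.
Qed.

End Plane.

(** * The canonical domain system *)

Section Omega.
Variable R : realType.

Lemma omega_lt (x y : R) : 0 <= x -> x < y -> y < 1 -> omega x < omega y.
Proof.
move=> x0 xy y1; have y0 : 0 < y by exact: le_lt_trans xy.
have ly : ln y < 0 by rewrite ln_lt0// y0.
rewrite /omega (gt_eqF y0); case: eqVneq => [_|xn0].
  by rewrite ltr_ndivlMr// mul0r oppr_lt0 pi_gt0.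
have x0' : 0 < x by rewrite lt_neqAle eq_sym xn0.
have lx : ln x < ln y by rewrite ltr_ln.
have lx0 : ln x < 0 by exact: lt_trans ly.
by rewrite ltr_nM2l ?oppr_lt0 ?pi_gt0// ltf_nV2.
Qed.

Variables (d : \bar R) (r : R -> R).
Hypothesis r01 : forall t, 0 <= t -> 0 <= r t < 1.
Hypothesis rAC : ACd d `[0, +oo[%classic `[0, +oo[%classic (fun t => omega (r t)).
Hypothesis rmono : forall s t, 0 <= s -> s <= t -> omega (r t) <= omega (r s).

Lemma radius_mono s t : 0 <= s -> s <= t -> r t <= r s.
Proof.
move=> s0 st; rewrite leNgt; apply/negP => h.
have /andP[rs0 _] := r01 s0; have /andP[_ rt1] := r01 (le_trans s0 st).
by have := omega_lt rs0 h rt1; rewrite ltNge rmono.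
Qed.

Lemma annulus_mono s t z : 0 <= s -> s <= t ->
  annulus (r s) z -> annulus (r t) z.
Proof.
move=> s0 st; rewrite /annulus /= => /andP[h ->]; rewrite andbT (le_lt_trans _ h)// lecR.
exact: radius_mono.
Qed.

(** By strict monotonicity of omega the condition r t < |z| reads
    omega (r t) < omega |z|, and omega o r is continuous. *)
Lemma annulus_left u z : 0 <= u -> annulus (r u) z ->
  exists2 dl, 0 < dl & forall t, 0 <= t -> u - dl < t -> annulus (r t) z.
Proof.
move=> u0; rewrite {1}/annulus /= => /andP[ru z1]; rewrite norm_normc ltcR in ru.
have nz1 : normc z < 1 by rewrite -ltcR -norm_normc.
have /andP[ru0 _] := r01 u0.
have w0 := omega_lt ru0 ru nz1.
have [_ /(_ 0 u) [|ac _]] := rAC.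
  by move=> x /=; rewrite !in_itv /= andbT => /andP[].
rewrite -subr_gt0 in w0; have [dl dl0 H] := ac _ w0.
exists dl => // t t0 ut; rewrite /annulus /= z1 andbT norm_normc ltcR.
have [tu|/ltW tu] := leP u t; first by rewrite (le_lt_trans _ ru)// radius_mono.
(* absolute continuity with a single interval is uniform continuity *)
have := H 1%N (fun=> t) (fun=> u); rewrite !big_ord1 => {}H.
have {}H : `|omega (r u) - omega (r t)| < omega (normc z) - omega (r u).
  apply: H => //; last by lra.
  by move=> i j _ _ _; rewrite !ord1.
rewrite ltNge; apply/negP => h.
have /andP[_ rt1] := r01 t0.
have : omega (normc z) <= omega (r t).
  by move: h; rewrite le_eqVlt => /predU1P[->//|h]; apply/ltW/omega_lt => //; exact: normc_ge0.
by move: H; rewrite ltr_norml => /andP[]; lra.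
Qed.

End Omega.

(** * Transition maps of a chain *)

Section Transition.
Variable R : realType.
Variables (D : R -> set (cplx R)) (f : R -> cplx R -> cplx R).
Hypothesis fU : forall t, 0 <= t -> univalent_on (D t) (f t).
Hypothesis fS : forall s t, 0 <= s -> s < t -> f s @` D s `<=` f t @` D t.
Local Notation phi := (chain_transition D f).

Lemma chain_inj t x y : 0 <= t -> D t x -> D t y -> f t x = f t y -> x = y.
Proof. by move=> /fU[_ fI] Dx Dy; apply: fI; rewrite inE. Qed.

Lemma chain_deriv t x : 0 <= t -> D t x -> derivable (f t) x 1.
Proof. by move=> /fU[[_ df] _]; exact: df. Qed.

Lemma chain_open t : 0 <= t -> open (D t).
Proof. by move=> /fU[[]]. Qed.

Lemma chain_transition_unique s t z b : 0 <= t -> D t b -> f t b = f s z ->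
  phi s t z = b.
Proof.
move=> t0 Db E; rewrite /chain_transition /= -E.
by apply: pinvKV; rewrite ?inE//; case: (fU t0).
Qed.

Lemma chain_transition_spec s t z : 0 <= s -> s <= t -> D s z ->
  D t (phi s t z) /\ f t (phi s t z) = f s z.
Proof.
move=> s0 st Dz; have t0 := le_trans s0 st.
have [b Db E] : exists2 b, D t b & f t b = f s z.
  move: st; rewrite le_eqVlt => /predU1P[<-|st]; first by exists z.
  by have [b Db E] := fS s0 st (ex_intro2 _ _ z Dz erefl); exists b.
by rewrite (chain_transition_unique t0 Db E).
Qed.

Lemma chain_transition_comp s u t z : 0 <= s -> s <= u -> u <= t -> D s z ->
  phi s t z = phi u t (phi s u z).
Proof.
move=> s0 su ut Dz; have u0 := le_trans s0 su; have t0 := le_trans u0 ut.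
have [Du Eu] := chain_transition_spec s0 su Dz.
have [Dt Et] := chain_transition_spec u0 ut Du.
by apply: chain_transition_unique => //; rewrite Et.
Qed.

(** Apply [stable_local_inverse] with h = f_t: f_s maps a neighbourhood of z
    into the set of values that f_t takes near phi_{s,t} z. *)
Lemma chain_transition_derivable s t z : 0 <= s -> s <= t -> D s z ->
  derivable (phi s t) z 1.
Proof.
move=> s0 st Dz; have t0 := le_trans s0 st.
have [Dw Ew] := chain_transition_spec s0 st Dz.
have [rho rho0 Hrho] := open_disc (chain_open t0) Dw.
have df x : disc (phi s t z) rho x -> derivable (f t) x 1.
  by move=> /Hrho; exact: chain_deriv.
have fI : disc_injective (phi s t z) rho (f t).
  by move=> x y /Hrho Dx /Hrho Dy; exact: chain_inj.
have [c [sg [eps [eta [[c0 sg0 sgr eps0 eta0] Q]]]]] := stable_local_inverse rho0 df fI.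
have hc0 x : disc (phi s t z) rho x -> normc (f t x - f t x) <= eps.
  by move=> _; rewrite subrr normc0 ltW.
have [low sur] := Q (f t) df hc0.
have [rs rs0 Hrs] := open_disc (chain_open s0) Dz.
have fsd := chain_deriv s0 Dz.
have [dl dl0 Hdl] := (contcP _ _).1 (derivable_cont fsd) eta eta0.
have Dc : disc (phi s t z) sg (phi s t z) by apply: disc_center; exact: ltW.
have dft : derivable (f t) (phi s t z) 1.
  by apply: df; apply: disc_center; exact: ltW.
apply: (derivable_preimage sg0 c0 fsd dft (fun a Da => low a _ Da Dc)).
have [m [m0 mdl mrs]] := exists_min2 dl0 rs0.
exists m => // w wm.
have Dsw : D s w by apply: Hrs; rewrite /disc; exact: le_trans (ltW wm) mrs.
have [b Db Eb] : exists2 b, disc (phi s t z) sg b & f t b = f s w.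
  by apply: sur; rewrite Ew; apply: Hdl; exact: lt_le_trans mdl.
have -> : phi s t w = b.
  by apply: chain_transition_unique => //; apply: Hrho; exact: disc_le Db.
by [].
Qed.

End Transition.

(** * Increments of the transition maps *)

Section LocalBound.
Variable R : realType.
Variable d : \bar R.
Hypothesis hd : (1 <= d)%E.
Variables (D : R -> set (cplx R)) (f : R -> cplx R -> cplx R).
Hypothesis fU : forall t, 0 <= t -> univalent_on (D t) (f t).
Hypothesis fS : forall s t, 0 <= s -> s < t -> f s @` D s `<=` f t @` D t.
Hypothesis fL : forall (S T : R) (K : set (cplx R)),
  0 <= S -> S <= T -> compact K -> K `<=` D S ->
  exists k : R -> R,
    [/\ forall x, x \in `[S, T] -> 0 <= k x,
        Ld_on d S T k &
        forall z s t, K z -> S <= s -> s <= t -> t <= T ->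
          `|f s z - f t z|
            <= (\int[lebesgue_measure]_(x in `[s, t]) k x)%:C%C].
Hypothesis Dmono : forall s t z, 0 <= s -> s <= t -> D s z -> D t z.
Hypothesis Dleft : forall u z, 0 <= u -> D u z ->
  exists2 dl : R, 0 < dl & forall t, 0 <= t -> u - dl < t -> D t z.
Local Notation phi := (chain_transition D f).

Lemma chain_time_bound S T K : 0 <= S -> S <= T -> compact K -> K `<=` D S ->
  exists k, [/\ forall x, x \in `[S, T] -> 0 <= k x, Ld_on d S T k &
    forall z s t, K z -> S <= s -> s <= t -> t <= T ->
      normc (f s z - f t z) <= time_int k s t].
Proof.
move=> S0 ST cK KD; have [k [k0 kL H]] := fL S0 ST cK KD.
exists k; split => // z s t Kz Ss st tT.
by rewrite -lecR -norm_normc; exact: H.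
Qed.

Lemma chain_time_cont S T K (x e : R) : 0 <= S -> S <= T -> compact K ->
  K `<=` D S -> S <= x <= T -> 0 < e ->
  exists2 dl, 0 < dl & forall z t, K z -> S <= t -> t <= T -> `|t - x| < dl ->
    normc (f t z - f x z) < e.
Proof.
move=> S0 ST cK KD xST e0; have [k [_ kL H]] := chain_time_bound S0 ST cK KD.
have [dl dl0 Hdl] := time_int_small ST (Ld_integrable hd kL) xST e0.
move/andP: (xST) => [Sx xT].
exists dl => // z t Kz St tT tx.
have xx : `|x - x| < dl by rewrite subrr normr0.
have [tx'|/ltW xt] := leP t x.
  by apply: le_lt_trans (H z t x Kz St tx' xT) _; exact: Hdl.
by rewrite normc_distC; apply: le_lt_trans (H z x t Kz Sx xt tT) _; exact: Hdl.
Qed.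

(** Near (s0, u0, u0) all transition points stay in one disc, where f_t is
    bounded below by c uniformly in t; the density is c^{-1} times that of the
    chain on this disc. *)
Lemma local_bound S T z s0 u0 : 0 <= S -> S <= s0 -> s0 <= u0 -> u0 <= T ->
  D S z ->
  exists2 dl, 0 < dl & exists2 k, admissible d S T k &
    forall s u t, S <= s -> s <= u -> u <= t -> t <= T ->
      `|s - s0| < dl -> `|u - u0| < dl -> `|t - u0| < dl ->
      normc (phi s u z - phi s t z) <= time_int k u t.
Proof.
move=> S0 Ss0 su0 u0T Dz.
have s00 := le_trans S0 Ss0; have u00 := le_trans s00 su0.
have Su0 := le_trans Ss0 su0; have ST := le_trans Su0 u0T.
have [Dw Ew] := chain_transition_spec fU fS s00 su0 (Dmono S0 Ss0 Dz).
set w0 := phi s0 u0 z in Dw Ew.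
have [d1 d10 Hd1] := Dleft u00 Dw.
(* the chain is controlled on compact subsets of D S', so S' is chosen before
   u0 if possible, yet with w0 still in D S' *)
pose S' := Num.max S (u0 - d1 / 2).
have SS' : S <= S' by rewrite le_max lexx.
have S'0 : 0 <= S' by exact: le_trans SS'.
have S'u : S' <= u0 by rewrite ge_max Su0 gerBl divr_ge0// ltW.
have S'T := le_trans S'u u0T.
have DS' : D S' w0.
  by apply: Hd1 => //; rewrite lt_max; apply/orP; right; lra.
have [rho2 rho20 Hrho2] := open_disc (chain_open fU S'0) DS'.
pose rho := rho2 / 2; have rho0 : 0 < rho by rewrite divr_gt0.
pose K := square w0 rho.
have cK : compact K by exact: compact_square.
have KD : K `<=` D S'.
  move=> x /square_disc Dx; apply: Hrho2; apply: disc_le Dx.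
  by rewrite /rho mulrC divfK.
have DK x : disc w0 rho x -> K x by exact: disc_square.
have dD t x : S' <= t -> disc w0 rho x -> D t x.
  by move=> St /DK /KD; exact: Dmono.
have [k1 [k10 k1L Hk1]] := chain_time_bound S'0 S'T cK KD.
have df t x : S' <= t -> disc w0 rho x -> derivable (f t) x 1.
  move=> St /(dD _ _ St); apply: chain_deriv => //; exact: le_trans St.
have fI : disc_injective w0 rho (f u0).
  by move=> x y /(dD _ _ S'u) Dx /(dD _ _ S'u) Dy; exact: (chain_inj fU u00).
have [c [sg [eps [eta [[c0 sg0 sgr eps0 eta0] Q]]]]] :=
  stable_local_inverse rho0 (fun x => @df u0 x S'u) fI.
have [e [e0 ee1 ee2]] := exists_min2 eps0 (divr_gt0 eta0 (ltr0Sn R 1)).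
have u0S'T : S' <= u0 <= T by rewrite S'u.
have [d2 d20 Hd2] := chain_time_cont S'0 S'T cK KD u0S'T e0.
have s0ST : S <= s0 <= T by rewrite Ss0 (le_trans su0).
have zD : [set z] `<=` D S by move=> _ ->.
have [d3 d30 Hd3] := chain_time_cont S0 ST (@compact_set1 _ z) zD s0ST e0.
have [m1 [m10 m1a m1b]] := exists_min2 (divr_gt0 d10 (ltr0Sn R 1)) d20.
have [dl [dl0 dla dlb]] := exists_min2 m10 d30.
exists dl => //.
pose k := k1 \_ `[S', T].
have kadm : admissible d S T k by exact: admissible_restrict.
have cV0 : 0 <= c^-1 by rewrite invr_ge0 ltW.
exists (fun x => c^-1 * k x); first exact: admissibleZ.
have D0 : disc w0 rho w0 by apply: disc_center; exact: ltW.
(* f_v takes the value f_s z in the disc, because f_s z is close to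
   f_{s0} z = f_{u0} w0 and hence to f_v w0 *)
have val s v : S <= s -> s <= v -> v <= T -> `|s - s0| < dl -> `|v - u0| < dl ->
    [/\ S' <= v, disc w0 sg (phi s v z), f v (phi s v z) = f s z &
      (forall a b, disc w0 sg a -> disc w0 sg b ->
       c * normc (a - b) <= normc (f v a - f v b))].
  move=> Ss sv vT ss0 vu0.
  have S'v : S' <= v.
    rewrite ge_max (le_trans Ss)//=.
    by move: vu0; rewrite ltr_norml => /andP[]; lra.
  have v0 := le_trans S'0 S'v.
  have vu0' : `|v - u0| < d2 by lra.
  have hc x : disc w0 rho x -> normc (f v x - f u0 x) <= eps.
    by move=> /DK Kx; apply: le_trans ee1; apply/ltW/Hd2.
  have [low sur] := Q (f v) (fun x => @df v x S'v) hc.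
  have [|b Db Eb] := sur (f s z).
    have h1 := Hd2 w0 v (DK _ D0) S'v vT vu0'.
    have h2 : normc (f s z - f s0 z) < e.
      by apply: Hd3 => //; [exact: le_trans vT|lra].
    have h3 := normc_dist_tri (f s0 z) (f s z) (f v w0).
    rewrite (normc_distC (f s0 z)) -Ew in h3; rewrite -Ew in h2; lra.
  have Eb' : phi s v z = b.
    by apply: (chain_transition_unique fU v0) => //; apply: dD => //; exact: disc_le Db.
  by rewrite Eb'.
move=> s u t Ss su ut tT ss0 uu0 tu0.
have uT := le_trans ut tT; have st := le_trans su ut.
have [S'u1 Du Eu _] := val s u Ss su uT ss0 uu0.
have [S't1 Dt Et low] := val s t Ss st tT ss0 tu0.
rewrite (time_intZ hd _ kadm (le_trans SS' S'u1) tT) mulrC ler_pdivlMr// mulrC.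
have -> : time_int k u t = time_int k1 u t.
  apply: eq_Rintegral => x; rewrite inE /= in_itv /= => /andP[h1 h2].
  by rewrite /k patchE mem_set //= in_itv /= (le_trans S'u1 h1) (le_trans h2 tT).
apply: (le_trans (low _ _ Du Dt)); rewrite Et -Eu normc_distC.
by apply: Hk1 => //; apply: DK; exact: disc_le Du.
Qed.

(** Densities for adjacent intervals are added, so [cousin] applies: first in
    the times u, t with s in a neighbourhood of s0, then in s. *)
Lemma transition_bound S T z : 0 <= S -> S <= T -> D S z ->
  exists2 k, admissible d S T k &
    forall s u t, S <= s -> s <= u -> u <= t -> t <= T ->
      normc (phi s u z - phi s t z) <= time_int k u t.
Proof.
move=> S0 ST Dz.
have glue k1 k2 s u b t : admissible d S T k1 -> admissible d S T k2 ->
    S <= u -> u <= b -> b <= t -> t <= T ->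
    normc (phi s u z - phi s b z) <= time_int k1 u b ->
    normc (phi s b z - phi s t z) <= time_int k2 b t ->
    normc (phi s u z - phi s t z) <= time_int (fun x => k1 x + k2 x) u t.
  move=> a1 a2 Su ub bt tT h1 h2; have a12 := admissibleD hd a1 a2.
  have Sb := le_trans Su ub; have bT := le_trans bt tT.
  rewrite (time_int_split (admissible_integrable hd a12 Su tT) ub bt).
  apply: (le_trans (normc_dist_tri (phi s b z) _ _)); apply: lerD.
    apply: (le_trans h1); apply: (le_time_int hd a1 a12 Su bT) => x.
    by rewrite lerDl; case: a2.
  apply: (le_trans h2); apply: (le_time_int hd a2 a12 Sb tT) => x.
  by rewrite lerDr; case: a1.
have mono1 k1 k2 u t : admissible d S T k1 -> admissible d S T k2 -> S <= u -> t <= T ->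
    time_int k1 u t <= time_int (fun x => k1 x + k2 x) u t.
  move=> a1 a2 Su tT; apply: (le_time_int hd a1 (admissibleD hd a1 a2) Su tT) => x.
  by rewrite lerDl; case: a2.
have mono2 k1 k2 u t : admissible d S T k1 -> admissible d S T k2 -> S <= u -> t <= T ->
    time_int k2 u t <= time_int (fun x => k1 x + k2 x) u t.
  move=> a1 a2 Su tT; apply: (le_time_int hd a2 (admissibleD hd a1 a2) Su tT) => x.
  by rewrite lerDr; case: a1.
pose B k s u t := normc (phi s u z - phi s t z) <= time_int k u t.
have near_s s0 : S <= s0 <= T -> exists2 dl, 0 < dl & exists2 k, admissible d S T k &
    forall s u t, `|s - s0| < dl -> S <= s -> s <= u -> u <= t -> t <= T ->
      B k s u t.
  move=> /andP[Ss0 s0T].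
  pose P a b := exists2 dl, 0 < dl & exists2 k, admissible d S T k &
    forall s u t, `|s - s0| < dl -> S <= s -> s <= u -> a <= u -> u <= t -> t <= b ->
      B k s u t.
  have [dl dl0 [k ka H]] : P S T.
    apply: cousin => //.
      move=> a b c Sa ab bc cT [dl1 dl10 [k1 a1 H1]] [dl2 dl20 [k2 a2 H2]].
      have [dl [dl0 h1 h2]] := exists_min2 dl10 dl20.
      exists dl => //; exists (fun x => k1 x + k2 x); first exact: admissibleD.
      move=> s u t ss0 Ss su au ut tc.
      have ss1 := lt_le_trans ss0 h1; have ss2 := lt_le_trans ss0 h2.
      have Su := le_trans Ss su; have tT := le_trans tc cT.
      have [tb|/ltW bt] := leP t b.
        by apply: le_trans (mono1 k1 k2 u t a1 a2 Su tT); exact: H1.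
      have [bu|/ltW ub] := leP b u.
        by apply: le_trans (mono2 k1 k2 u t a1 a2 Su tT); exact: H2.
      apply: (glue k1 k2 s u b t) => //; first exact: H1.
      by apply: H2 => //; exact: le_trans ub.
    move=> u0 /andP[Su0 u0T].
    have [su0|us0] := leP s0 u0.
      have [dl dl0 [k ka H]] := local_bound S0 Ss0 su0 u0T Dz.
      exists dl => // a b Sa au0 ub bT adl bdl.
      exists dl => //; exists k => // s u t ss0 Ss su au ut tb.
      by apply: H => //; [lra|rewrite ltr_norml; lra|rewrite ltr_norml; lra].
    (* no times s <= u <= t are close to s0, u0, u0 *)
    have d0 : 0 < (s0 - u0) / 2 by lra.
    exists ((s0 - u0) / 2) => // a b Sa au0 ub bT adl bdl.
    exists ((s0 - u0) / 2) => //; exists (fun=> 0); first exact: admissible0.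
    by move=> s u t; rewrite ltr_norml; lra.
  exists dl => //; exists k => // s u t ss0 Ss su ut tT.
  by apply: H => //; exact: le_trans su.
pose P a b := exists2 k, admissible d S T k &
    forall s u t, a <= s -> s <= b -> s <= u -> u <= t -> t <= T -> B k s u t.
have [k ka H] : P S T.
  apply: cousin => //.
    move=> a b c Sa ab bc cT [k1 a1 H1] [k2 a2 H2].
    exists (fun x => k1 x + k2 x); first exact: admissibleD.
    move=> s u t as_ sc su ut tT.
    have Su : S <= u by rewrite (le_trans Sa)// (le_trans as_).
    have [sb|/ltW bs] := leP s b.
      by apply: le_trans (mono1 k1 k2 u t a1 a2 Su tT); exact: H1.
    by apply: le_trans (mono2 k1 k2 u t a1 a2 Su tT); exact: H2.
  move=> s0 /near_s[dl dl0 [k ka H]]; exists dl => // a b Sa as0 sb bT adl bdl.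
  exists k => // s u t as_ sb' su ut tT.
  by apply: H => //; [rewrite ltr_norml; lra|exact: le_trans as_].
by exists k => // s u t Ss su ut tT; apply: H => //; lra.
Qed.

End LocalBound.

Theorem theorem1p9 (R : realType) (d : \bar R) (hd : (1 <= d)%E)
    (D : R -> set (cplx R)) (f : R -> cplx R -> cplx R)
    (hD : canonical_domain_system d D) (hf : loewner_chain d D f) :
  evolution_family d D (chain_transition D f).
Proof.
have [r [r01 DE rAC rmono]] := hD; have [fU fS fL] := hf.
have Dmono s t z : 0 <= s -> s <= t -> D s z -> D t z.
  move=> s0 st; rewrite !DE//; last exact: le_trans st.
  exact: (annulus_mono r01 rmono).
have Dleft u z : 0 <= u -> D u z ->
    exists2 dl : R, 0 < dl & forall t, 0 <= t -> u - dl < t -> D t z.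
  move=> u0; rewrite DE// => /(annulus_left r01 rAC rmono u0)[dl dl0 H].
  by exists dl => // t t0 ut; rewrite DE//; exact: H.
split.
- move=> s t s0 st; split.
    split; first exact: (chain_open fU).
    by move=> z; exact: (chain_transition_derivable fU fS).
  by move=> _ [z Dz <-]; case: (chain_transition_spec fU fS s0 st Dz).
- by move=> s z s0 Dz; exact: (chain_transition_unique fU s0).
- by move=> s u t z; exact: (chain_transition_comp fU fS).
- move=> S T z S0 ST Dz.
  have [k [k0 kL] H] := transition_bound hd fU fS fL Dmono Dleft S0 ST Dz.
  exists k; split => // s u t Ss su ut tT.
  by rewrite norm_normc lecR; exact: H.
Qed.
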